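(* For every compact $K\subset D$, there is a constant $C_K>0$ such that $$|v(t,\ell,m)-v(t,\ell',m')|\le C_K\bigl(|\ell-\ell'|+|m-m'|\bigr)$$ for all $t\in[0,T]$ and all $(\ell,m),(\ell',m')\in K$.
   Context: Fix $T>0$, constants $\lambda,\sigma,\kappa,\beta>0$, $b\ge0$, $a,\alpha_0,\underline\ell\in\mathbb R$, $\underline\delta<0<\overline\delta$, $A=[\underline\delta,\overline\delta]$, and bounded continuous deterministic functions $\Theta,B:[0,T]\to\mathbb R$ and $\Pi:[0,T]\to[0,\infty)$. Let $(\Omega,\mathcal F,\mathbb F=(\mathcal F_t)_{0\le t\le T},\mathbb P)$ be a filtered probability space satisfying the usual conditions and supporting an $\mathbb F$-Brownian motion $W$. $\mathcal A_t$ denotes the set of $\mathbb F$-progressively measurable $A$-valued processes on $[t,T]$. Let $D=\{(\ell,m)\in\mathbb R^2:\underline\ell\le\ell\le m\}$. For $t\in[0,T]$, $\ell\ge\underline\ell$, $\delta\in\mathcal A_t$, the load $L=L^{t,\ell,\delta}$ is the (pathwise unique) continuous adapted solution, together with a reflection process $k$, of the reflected equation on $[t,T]$ $$dL_s=[-\lambda(L_s-\Theta_s)+\delta_s]\,ds+\sigma\,dW_s+dk_s,\quad L_t=\ell,\quad L_s\ge\underline\ell,$$ where $k$ is continuous, adapted, nondecreasing, $k_t=0$ and $\int_t^T\mathbf 1_{\{L_s>\underline\ell\}}\,dk_s=0$. For $m\ge\ell$ the running maximum is $M_s^{t,\ell,m,\delta}=\max\{m,\sup_{u\in[t,s]}L_u^{t,\ell,\delta}\}$.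 The running cost is $f(t,\ell,\delta)=(a+b\ell-\alpha_0)\delta+\frac{\beta}{2}\delta^2$. The function $\varphi:[\underline\ell,\infty)\to\mathbb R$ is convex, nondecreasing, $C^2$, of at most polynomial growth, with $\varphi'(\underline\ell)\ge0$. With $L=L^{t,\ell,\delta}$, $M=M^{t,\ell,m,\delta}$, $$J(t,\ell,m;\delta)=\mathbb E\left[\int_t^T f(s,L_s,\delta_s)\,ds+\kappa\int_t^T\varphi'(L_s)\,dM_s-\int_t^T\Pi_s(B_s-L_s)^+\,ds\right],$$ where the $dM$ integral is a pathwise Stieltjes integral, and the value function is $v(t,\ell,m)=\inf_{\delta\in\mathcal A_t}J(t,\ell,m;\delta)$, with $v(T,\cdot)=0$. *)

(* Defs.v *)
From HB Require Import structures.
From mathcomp Require Import all_boot all_order all_algebra.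
From mathcomp Require Import all_classical all_reals all_analysis.
Set Implicit Arguments.
Unset Strict Implicit.
Unset Printing Implicit Defensive.
Import Order.TTheory GRing.Theory Num.Theory.
Import numFieldNormedType.Exports.
Local Open Scope classical_set_scope.
Local Open Scope ring_scope.

(* A process is a function X : R -> Omega -> R, time first. Time is a real
   number, and only the values at times of the relevant interval matter. *)

(* The difference quotient is taken inside S, so that at an endpoint of an
   interval S the derivative is the one-sided one. *)
Section calculus_on.
Context {R : realType}.
Implicit Types (S : set R) (f : R -> R).

Definition diff_quotient f (x y : R) : R := (f y - f x) / (y - x).

Definition derivable_on S f (x : R) : Prop :=
  cvg (diff_quotient f x @ within S x^').

Definition derive_on S f (x : R) : R :=
  lim (diff_quotient f x @ within S x^').

Definition C2_on S f : Prop :=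
  [/\ forall x, S x -> derivable_on S f x,
      forall x, S x -> derivable_on S (derive_on S f) x &
      {within S, continuous (derive_on S (derive_on S f))}].

End calculus_on.

Section stieltjes.
Context {R : realType}.

(* g on [t, T], extended by constants to the whole line *)
Definition clamp (t T : R) (g : R -> R) (s : R) : R :=
  g (Num.max t (Num.min s T)).

Definition to_cumulative (g : R -> R) (nd : nondecreasing g)
  (rc : right_continuous g) : cumulative R R :=
  HB.pack g (isCumulative.Build R _ R g nd rc).

(* Integral of h against dg over [t, T], for g nondecreasing and
   right-continuous on [t, T] (with the junk value 0 otherwise). The extension
   by constants puts no mass at t. *)
Definition stieltjes_integral (t T : R) (h g : R -> R) : \bar R :=
  match pselect (nondecreasing (clamp t T g)),
        pselect (right_continuous (clamp t T g)) with
  | left nd, left rc =>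
      (\int[lebesgue_stieltjes_measure (to_cumulative nd rc)]_(s in `[t, T])
         (h s)%:E)%E
  | _, _ => 0%E
  end.

End stieltjes.

Section stochastic_basis.
Context {R : realType} {d : measure_display} {Omega : measurableType d}.
Variables (T : R) (P : probability Omega R) (F : R -> set (set Omega)).

Record usual_conditions : Prop := {
  uc_sigma : forall s : R, 0 <= s <= T -> sigma_algebra setT (F s);
  uc_measurable : forall s : R, 0 <= s <= T -> F s `<=` measurable;
  uc_mono : forall s u : R, 0 <= s -> s <= u -> u <= T -> F s `<=` F u;
  uc_right : forall s : R, 0 <= s < T ->
    \bigcap_(u in `]s, T]) F u `<=` F s;
  uc_complete : P.-negligible `<=` F 0 }.

Definition adapted (t : R) (X : R -> Omega -> R) : Prop :=
  forall s, t <= s <= T ->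
    measurable_fun setT (X s : g_sigma_algebraType (F s) -> R).

Definition progressive (t : R) (X : R -> Omega -> R) : Prop :=
  forall s, t <= s <= T ->
    measurable_fun (`[t, s] `*` setT)
      (fun z : (measurableTypeR R * g_sigma_algebraType (F s))%type =>
         X z.1 z.2).

Definition increment (W : R -> Omega -> R) (s u : R) (w : Omega) : R :=
  W u w - W s w.

Record brownian_motion (W : R -> Omega -> R) : Prop := {
  bm_adapted : adapted 0 W;
  bm_zero : {ae P, forall w, W 0 w = 0};
  bm_continuous : {ae P, forall w, {within `[0, T], continuous (W^~ w)}};
  bm_gaussian : forall s u : R, 0 <= s -> s < u -> u <= T ->
    forall B : set R, measurable B ->
      P (increment W s u @^-1` B) = normal_prob 0 (Num.sqrt (u - s)) B;
  bm_independent : forall s u : R, 0 <= s -> s < u -> u <= T ->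
    forall A (B : set R), F s A -> measurable B ->
      P (A `&` increment W s u @^-1` B)
        = (P A * P (increment W s u @^-1` B))%E }.

End stochastic_basis.

Record model (R : realType) := Model {
  horizon : R;        (* T *)
  lambda : R;
  sigma : R;
  kappa : R;
  beta : R;
  slope : R;          (* b *)
  icpt : R;           (* a *)
  alpha0 : R;
  lfloor : R;         (* reflecting barrier, lower bound of the load *)
  dmin : R;           (* the control set A is [dmin, dmax] *)
  dmax : R;
  Theta : R -> R;
  Bfun : R -> R;
  Pifun : R -> R;
  phi : R -> R }.     (* only its values on [lfloor, +oo[ matter *)

Section control.
Context {R : realType} (p : model R).
Let T := horizon p.

Definition load_range : set R := `[lfloor p, +oo[.

Definition state_space : set (R * R) :=
  [set x | lfloor p <= x.1 /\ x.1 <= x.2].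

Definition dphi : R -> R := derive_on load_range (phi p).

Record standing_assumptions : Prop := {
  sa_T : 0 < T;
  sa_lambda : 0 < lambda p;
  sa_sigma : 0 < sigma p;
  sa_kappa : 0 < kappa p;
  sa_beta : 0 < beta p;
  sa_slope : 0 <= slope p;
  sa_dmin : dmin p < 0;
  sa_dmax : 0 < dmax p;
  sa_Theta_cont : {within `[0, T], continuous (Theta p)};
  sa_Theta_bnd : exists C : R, forall s : R, 0 <= s <= T -> `|Theta p s| <= C;
  sa_B_cont : {within `[0, T], continuous (Bfun p)};
  sa_B_bnd : exists C : R, forall s : R, 0 <= s <= T -> `|Bfun p s| <= C;
  sa_Pi_cont : {within `[0, T], continuous (Pifun p)};
  sa_Pi_bnd : exists C : R, forall s : R, 0 <= s <= T -> `|Pifun p s| <= C;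
  sa_Pi_ge0 : forall s : R, 0 <= s <= T -> 0 <= Pifun p s;
  sa_phi_convex : convex_function load_range (phi p);
  sa_phi_mono : forall x y : R, lfloor p <= x -> x <= y -> phi p x <= phi p y;
  sa_phi_C2 : C2_on load_range (phi p);
  sa_phi_growth : exists (C : R) (n : nat),
    forall x : R, lfloor p <= x -> `|phi p x| <= C * (1 + `|x| ^+ n);
  sa_dphi_ge0 : 0 <= dphi (lfloor p) }.

Definition running_cost (l dl : R) : R :=
  (icpt p + slope p * l - alpha0 p) * dl + beta p / 2 * dl ^+ 2.

Context {d : measure_display} {Omega : measurableType d}.
Variables (P : probability Omega R) (F : R -> set (set Omega)).
Variable (W : R -> Omega -> R).
Implicit Types (delta L k : R -> Omega -> R).

Definition admissible (t : R) : set (R -> Omega -> R) :=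
  [set delta | progressive T F t delta /\
     forall s w, t <= s <= T -> dmin p <= delta s w <= dmax p].

(* The noise is additive, so its stochastic integral over [t, s] is
   sigma (W_s - W_t). *)
Record reflected_path (t l : R) (W_ delta_ L_ k_ : R -> R) : Prop := {
  rp_L_cont : {within `[t, T], continuous L_};
  rp_k_cont : {within `[t, T], continuous k_};
  rp_equation : forall s : R, t <= s <= T ->
    L_ s = l + (\int[lebesgue_measure]_(u in `[t, s])
                  (- lambda p * (L_ u - Theta p u) + delta_ u))%R
             + sigma p * (W_ s - W_ t) + k_ s;
  rp_floor : forall s : R, t <= s <= T -> lfloor p <= L_ s;
  rp_k_start : k_ t = 0;
  rp_k_mono : forall s u : R, t <= s -> s <= u -> u <= T -> k_ s <= k_ u;
  rp_k_flat : stieltjes_integral t T \1_[set s | lfloor p < L_ s] k_ = 0%E }.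

Definition reflected_solution (t l : R) delta L k : Prop :=
  [/\ adapted T F t L, adapted T F t k &
      {ae P, forall w, reflected_path t l (W^~ w) (delta^~ w) (L^~ w) (k^~ w)}].

(* The load is given as data because the solution of the reflected equation is
   only determined up to indistinguishability, which does not affect the cost. *)
Definition load_family
    (L k : R -> R -> (R -> Omega -> R) -> R -> Omega -> R) : Prop :=
  forall t l delta, 0 <= t <= T -> lfloor p <= l -> admissible t delta ->
    reflected_solution t l delta (L t l delta) (k t l delta).

Definition running_max (t m : R) (L_ : R -> R) (s : R) : R :=
  Num.max m (sup [set L_ u | u in `[t, s]]).

Definition path_cost (t m : R) (L_ delta_ : R -> R) : R :=
  (\int[lebesgue_measure]_(s in `[t, T]) running_cost (L_ s) (delta_ s))%R
  + kappa p * fine (stieltjes_integral t T (dphi \o L_) (running_max t m L_))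
  - (\int[lebesgue_measure]_(s in `[t, T])
       (Pifun p s * Num.max (Bfun p s - L_ s) 0))%R.

Variable L : R -> R -> (R -> Omega -> R) -> R -> Omega -> R.

Definition cost (t l m : R) delta : \bar R :=
  'E_P[fun w => path_cost t m (L t l delta ^~ w) (delta^~ w)].

(* At t = T the cost vanishes, which gives the terminal value 0. *)
Definition value (t l m : R) : \bar R :=
  ereal_inf [set cost t l m delta | delta in admissible t].

End control.

(* Main.v *)
Require Import Defs.
From HB Require Import structures.
From mathcomp Require Import all_boot all_order all_algebra.
From mathcomp Require Import all_classical all_reals all_analysis.
From mathcomp Require Import measurable_realfun zify ring lra.
Set Implicit Arguments.
Unset Strict Implicit.
Unset Printing Implicit Defensive.
Import Order.TTheory GRing.Theory Num.Theory.
Import numFieldNormedType.Exports.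
Local Open Scope classical_set_scope.
Local Open Scope ring_scope.

(** Fix a control and a realization of the noise, and start the load from two
    initial points (l, m) and (l', m'). Three facts hold path by path.

    - The two loads stay at distance at most |l - l'| (reflected_contraction):
      the noise is additive and cancels, the drift is mean reverting, and the
      reflection of the lower load only brings the two closer. The two running
      maxima then stay at distance at most |l - l'| + |m - m'|
      (running_max_distance).

    - The running maximum M increases only at times when L = M. The integral of
      phi'(L) against dM is therefore the integral of phi'(M) against dM, that
      is, phi (M_T) - phi m (penalty_telescopes). So the penalty depends on the
      path through M_T only, and is as regular as phi. Convexity turns the
      polynomial growth of phi into one of phi' (phi_polynomial_growth).

    - The load is at most a constant plus 2 sigma S, where S is the supremum of
      |W_s - W_0| over [0, T] (reflected_upper_bound).

    Since the running cost and the shortfall are Lipschitz in the load, the two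
    path costs differ by at most C (1 + S)^N (|l - l'| + |m - m'|), and each of
    them is at most C (1 + S)^N, where C and N do not depend on the time, on the
    control, or on the initial points in a given bounded set
    (path_cost_estimates).

    It remains to average. S has moments of all orders (brownian_sup_moment):
    the Gaussian increments over the dyadic intervals of length T / 2^j have
    moments of order 2q proportional to 2^(-jq), small enough to beat the number
    2^j of these intervals, and the path at a dyadic time is a sum of one such
    increment per level. The path costs enter their expectations through lower
    integrals of positive and negative parts, and lower integrals are
    subadditive as soon as one of the two summands is measurable: a measurable
    integrable majorant of the distance of two integrands controls the distance
    of their integrals (integral_distance_ae). The resulting bound is uniform in
    the control and passes to the infimum (ereal_inf_distance). *)

(** * Local continuity and last exits *)

Section real_analysis.
Context {R : realType}.
Implicit Types (A : set R) (f g : R -> R).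

Lemma within_continuous_eps A f (x e : R) : {within A, continuous f} -> A x ->
  0 < e -> exists2 d : R, 0 < d & forall y, A y -> `|y - x| < d -> `|f y - f x| < e.
Proof.
move=> /subspace_continuousP fA Ax e0.
have /cvgrPdist_lt/(_ e e0) := fA x Ax.
rewrite near_withinE => /nbhs_ballP[d /= d0 H].
exists d => // y Ay yx; rewrite distrC; apply: H => //.
by rewrite /ball /= distrC.
Qed.

Lemma eps_within_continuous (A : set R) (f : R -> R) :
  (forall x e : R, A x -> 0 < e -> exists2 d : R, 0 < d &
     forall y, A y -> `|y - x| < d -> `|f y - f x| < e) ->
  {within A, continuous f}.
Proof.
move=> H; apply/subspace_continuousP => x Ax; apply/cvgrPdist_lt => e e0.
have [d d0 Hd] := H x e Ax e0.
rewrite near_withinE; apply/nbhs_ballP; exists d => //= y.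
by rewrite /ball /= distrC => yx Ay; rewrite distrC; exact: Hd.
Qed.

(** The supremum of the endpoints reachable from a is itself reachable, and the
    local hypothesis at that supremum pushes it up to b. *)
Lemma itv_local_to_global (a b : R) (Q : R -> R -> Prop) : a <= b ->
  (forall u v w, Q u v -> Q v w -> Q u w) ->
  (forall x, a <= x <= b -> exists2 d : R, 0 < d & forall u v,
     a <= u -> x - d < u -> u <= x -> x <= v -> v < x + d -> v <= b -> Q u v) ->
  Q a b.
Proof.
move=> ab Qtrans Qloc.
pose S := [set s | a <= s <= b /\ Q a s].
have Sa : S a.
  split; first by rewrite lexx.
  have [|d d0 H] := Qloc a; first by rewrite lexx.
  by apply: H; lra.
have Sub : has_ubound S by exists b => s [/andP[]].
have supS : has_sup S by split => //; exists a.
pose c := sup S.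
have ac : a <= c by apply: ub_le_sup.
have cb : c <= b by apply: ge_sup; [exists a|move=> s [/andP[]]].
have [|d d0 H] := Qloc c; first by rewrite ac.
have [s [/andP[as_ sb] Qs] sd] := sup_adherent d0 supS.
have sc : s <= c by apply: ub_le_sup => //; split => //; rewrite as_.
have [ltcb|] := ltP c b; last first.
  move=> bc; have <- : c = b by apply/eqP; rewrite eq_le cb.
  by apply: Qtrans Qs _; apply: H => //; lra.
pose v := Num.min b (c + d / 2).
have cv : c < v by rewrite lt_min ltcb; lra.
have vd : v < c + d by rewrite gt_min; apply/orP; right; lra.
have vb : v <= b by rewrite ge_min lexx.
have : v <= c.
  apply: ub_le_sup => //; split; first by rewrite vb; lra.
  by apply: Qtrans Qs _; apply: H => //; lra.
by rewrite leNgt cv.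
Qed.

(** u is the supremum of the times up to s at which g <= c. *)
Lemma last_time_below g (a s c : R) : a <= s -> {within `[a, s], continuous g} ->
  g a <= c ->
  exists u, [/\ a <= u <= s, g u <= c & forall r, u < r <= s -> c < g r].
Proof.
move=> as_ gc ga.
pose S := [set r | a <= r <= s /\ g r <= c].
have Sa : S a by split => //; rewrite lexx.
have Sub : has_ubound S by exists s => r [/andP[]].
have supS : has_sup S by split => //; exists a.
have au : a <= sup S by apply: ub_le_sup.
have us : sup S <= s by apply: ge_sup; [exists a|move=> r [/andP[]]].
exists (sup S); split; first by rewrite au.
- rewrite leNgt; apply/negP => cg.
  have [||d d0 H] := within_continuous_eps (x := sup S) (e := g (sup S) - c) gc.
  + by rewrite /= in_itv /= au.
  + by rewrite subr_gt0.
  have [r [/andP[ar rs] gr] rd] := sup_adherent d0 supS.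
  have ru : r <= sup S by apply: ub_le_sup => //; split => //; rewrite ar.
  have := H r; rewrite /= in_itv /= ar rs => /(_ isT).
  rewrite ler0_norm ?subr_le0// => /(_ _).
  have -> : (- (r - sup S) < d) = true by apply/idP; lra.
  by move=> /(_ isT); rewrite ltr_norml => /andP[]; lra.
- move=> r /andP[ur rs]; rewrite ltNge; apply/negP => gr.
  have : r <= sup S by apply: ub_le_sup => //; split => //; rewrite rs andbT; lra.
  by rewrite leNgt ur.
Qed.

(** Only the excursion above c that contains s matters. This is how reflected
    equations are used: above the floor the reflection term is idle, so an
    excursion is governed by the drift and the noise alone. *)
Lemma le_of_last_exit g (a b c e : R) : {within `[a, b], continuous g} ->
  g a <= c ->
  (forall u s, a <= u -> u <= s -> s <= b ->
     (forall r, u < r <= s -> c < g r) -> g s <= g u + e) ->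
  forall s, a <= s <= b -> g s <= c + e.
Proof.
move=> gc ga step s /andP[as_ sb].
have [|u [/andP[au us] gu above]] := last_time_below as_ _ ga.
  apply: continuous_subspaceW gc => r /=; rewrite !in_itv /=.
  by move=> /andP[-> rs]; lra.
by have := step u s au us sb above; lra.
Qed.

End real_analysis.

(** * One-sided derivatives and convexity *)

Section derivative_on.
Context {R : realType}.
Implicit Types (S : set R) (f : R -> R).

Lemma derivable_on_eps S f (x e : R) : derivable_on S f x -> 0 < e ->
  exists2 d : R, 0 < d & forall y, S y -> y != x -> `|y - x| < d ->
    `|diff_quotient f x y - derive_on S f x| < e.
Proof.
move=> Df e0.
have /cvgrPdist_lt/(_ e e0) : diff_quotient f x @ within S x^' --> derive_on S f x.
  exact: Df.
rewrite near_withinE /dnbhs near_withinE => /nbhs_ballP[d /= d0 H].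
exists d => // y Sy yx yd; rewrite distrC; apply: H => //.
by rewrite /ball /= distrC.
Qed.

Lemma derivable_on_continuous S f (x e : R) : derivable_on S f x -> 0 < e ->
  exists2 d : R, 0 < d & forall y, S y -> `|y - x| < d -> `|f y - f x| < e.
Proof.
move=> Df e0.
have [d d0 H] := derivable_on_eps Df ltr01.
pose B := `|derive_on S f x| + 1.
have B0 : 0 < B by rewrite /B; have := normr_ge0 (derive_on S f x); lra.
exists (Num.min d (e / B)).
  by rewrite lt_min d0 divr_gt0.
move=> y Sy; rewrite lt_min => /andP[yd yB].
have [->|yx] := eqVneq y x; first by rewrite subrr normr0.
have := H y Sy yx yd.
have -> : f y - f x = diff_quotient f x y * (y - x).
  by rewrite /diff_quotient divfK// subr_eq0.
set q := diff_quotient _ _ _ => qd.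
have qB : `|q| <= B.
  have -> : q = (q - derive_on S f x) + derive_on S f x by ring.
  by apply: le_trans (ler_normD _ _) _; rewrite /B; lra.
rewrite normrM; apply: (@le_lt_trans _ _ (B * `|y - x|)).
  by rewrite ler_wpM2r.
by rewrite mulrC -ltr_pdivlMr.
Qed.

Lemma convex_functionE S f : convex_function S f ->
  forall x y (t : R), S x -> S y -> 0 <= t -> t <= 1 ->
  f (t * x + (1 - t) * y) <= t * f x + (1 - t) * f y.
Proof.
move=> cf x y t Sx Sy t0 t1.
have tI : Itv.spec (@Itv.num_sem R) (Itv.Real `[0%Z, 1%Z]) t.
  by rewrite /= /Itv.num_sem num_real /= in_itv /= t0 t1.
have := cf (Itv.mk tI) x y; rewrite !inE => /(_ Sx Sy).
by rewrite !convRE /=.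
Qed.

(** If the slope at x exceeded that of the chord, so would the difference
    quotient at a point of the segment close to x, against convexity. The set S
    may end at x: only points of the segment are compared. *)
Lemma convex_tangent S f x y : convex_function S f -> derivable_on S f x ->
  (forall t, 0 <= t -> t <= 1 -> S (t * y + (1 - t) * x)) ->
  derive_on S f x * (y - x) <= f y - f x.
Proof.
move=> cf Df Sxy; rewrite leNgt; apply/negP => lt.
have Sx : S x by have := Sxy 0 (lexx _) ler01; rewrite mul0r add0r subr0 mul1r.
have Sy : S y by have := Sxy 1 ler01 (lexx _); rewrite subrr mul0r addr0 mul1r.
have [yx|yx] := eqVneq y x; first by move: lt; rewrite yx !subrr mulr0 ltxx.
have n0 : 0 < `|y - x| by rewrite normr_gt0 subr_eq0.
set D := derive_on S f x in lt *.
pose e := (D * (y - x) - (f y - f x)) / `|y - x|.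
have e0 : 0 < e by rewrite divr_gt0// subr_gt0.
have [d d0 H] := derivable_on_eps Df e0.
pose t := Num.min 1 (d / (2 * `|y - x|)).
have t0 : 0 < t by rewrite lt_min ltr01 divr_gt0// mulr_gt0.
have t1 : t <= 1 by rewrite ge_min lexx.
pose z := t * y + (1 - t) * x.
have zx : z - x = t * (y - x) by rewrite /z; ring.
have zx0 : z != x.
  by rewrite -subr_eq0 zx; apply: mulf_neq0; [rewrite gt_eqF|rewrite subr_eq0].
have zd : `|z - x| < d.
  rewrite zx normrM (gtr0_norm t0).
  apply: (@le_lt_trans _ _ (d / (2 * `|y - x|) * `|y - x|)).
    by rewrite ler_wpM2r// ge_min lexx orbT.
  by rewrite invfM mulrA divfK ?gt_eqF//; lra.
have := H z (Sxy _ (ltW t0) t1) zx0 zd.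
have cz : f z - f x <= t * (f y - f x).
  by have := convex_functionE cf Sy Sx (ltW t0) t1; rewrite -/z; lra.
have qz : diff_quotient f x z * (y - x) <= f y - f x.
  rewrite -(ler_pM2l t0); apply: le_trans cz.
  rewrite mulrCA -zx /diff_quotient [leLHS]divfK//.
  by rewrite subr_eq0.
rewrite -/D -(ltr_pM2r n0) -normrM /e divfK ?gt_eqF// ltr_norml => /andP[].
lra.
Qed.

End derivative_on.

(** * Stieltjes integrals on a compact interval *)

Section bounded_integrable.
Context {R : realType}.

Lemma continuous_itv_bounded (a b : R) (f : R -> R) :
  {within `[a, b], continuous f} ->
  exists C, forall x, a <= x <= b -> `|f x| <= C.
Proof.
move=> fc; have [ab|ba] := leP a b; last first.
  by exists 0 => x /andP[ax xb]; lra.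
have [c _ cmax] := EVT_max ab fc; have [e _ emin] := EVT_min ab fc.
exists (`|f c| + `|f e|) => x xab.
have := cmax x; have := emin x; rewrite !in_itv /= => /(_ xab) h1 /(_ xab) h2.
have := ler_norm (f c); have := ler_norm (- f e); rewrite normrN => h3 h4.
have := normr_ge0 (f c); have := normr_ge0 (f e) => h5 h6.
by rewrite ler_norml; apply/andP; split; lra.
Qed.

Lemma bounded_integrable d (X : measurableType d)
    (mu : {measure set X -> \bar R}) (A : set X) (f : X -> R) (C : R) :
  measurable A -> (mu A < +oo)%E -> measurable_fun A f ->
  (forall x, A x -> `|f x| <= C) -> mu.-integrable A (EFin \o f).
Proof.
move=> mA muA mf fC; apply: measurable_bounded_integrable => //.
exists C; split; first exact: num_real.
by move=> M CM x Ax; apply: le_trans (fC x Ax) (ltW CM).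
Qed.

Lemma continuous_itv_measurable (a b : R) (f : R -> R) :
  {within `[a, b], continuous f} -> measurable_fun `[a, b] f.
Proof. by move=> fc; apply: subspace_continuous_measurable_fun. Qed.

End bounded_integrable.

Section dist_max_min.
Context {R : realType}.
Implicit Types a x y : R.

Lemma dist_maxr_le a x y : `|Num.max a x - Num.max a y| <= `|x - y|.
Proof.
have := ler_norm (x - y); have := ler_norm (- (x - y)); rewrite normrN.
set n := `|x - y| => n1 n2; rewrite ler_norml.
by case: (leP a x) => ?; case: (leP a y) => ?; apply/andP; split; lra.
Qed.

Lemma dist_minr_le a x y : `|Num.min x a - Num.min y a| <= `|x - y|.
Proof.
have := ler_norm (x - y); have := ler_norm (- (x - y)); rewrite normrN.
set n := `|x - y| => n1 n2; rewrite ler_norml.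
by case: (leP x a) => ?; case: (leP y a) => ?; apply/andP; split; lra.
Qed.

End dist_max_min.

Section stieltjes.
Context {R : realType}.
Variables (t T : R).
Hypothesis tT : t <= T.
Implicit Types (g h : R -> R).

Lemma clamp_in s : t <= Num.max t (Num.min s T) <= T.
Proof. by rewrite le_max lexx ge_max tT ge_min lexx orbT. Qed.

Lemma clampE g s : t <= s <= T -> clamp t T g s = g s.
Proof. by move=> /andP[ts sT]; rewrite /clamp min_l// max_r. Qed.

Lemma clamp_left g s : s <= t -> clamp t T g s = g t.
Proof. by move=> st; rewrite /clamp max_l// ge_min st. Qed.

(** Clamping the argument to [t, T] is monotone and 1-Lipschitz, so that the
    regularity of g on [t, T] passes to the extension by constants. *)
Lemma clamp_nondecreasing g :
  (forall s u, t <= s -> s <= u -> u <= T -> g s <= g u) ->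
  nondecreasing (clamp t T g).
Proof.
move=> gm s u su; have /andP[a1 _] := clamp_in s; have /andP[_ b2] := clamp_in u.
apply: gm => //.
case: (leP s T) => sT; case: (leP u T) => uT;
  case: (lerP t s) => ?; case: (lerP t u) => ?; case: (lerP t T) => ?; lra.
Qed.

Lemma clamp_right_continuous g : {within `[t, T], continuous g} ->
  right_continuous (clamp t T g).
Proof.
move=> gc; apply: right_continuousW => x.
apply/cvgrPdist_lt => e e0.
have [||d d0 H] := within_continuous_eps (x := Num.max t (Num.min x T)) (e := e) gc.
- by rewrite /= in_itv /= clamp_in.
- exact: e0.
apply/nbhs_ballP; exists d => //= y; rewrite /ball /= => xy.
rewrite distrC; apply: H; first by rewrite /= in_itv /= clamp_in.
apply: le_lt_trans xy; rewrite [leRHS]distrC.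
by apply: le_trans (dist_maxr_le _ _ _) (dist_minr_le _ _ _).
Qed.

Lemma stieltjes_integralE g h (nd : nondecreasing (clamp t T g))
    (rc : right_continuous (clamp t T g)) :
  stieltjes_integral t T h g =
  (\int[lebesgue_stieltjes_measure (to_cumulative nd rc)]_(s in `[t, T])
      (h s)%:E)%E.
Proof.
by rewrite /stieltjes_integral; case: pselect => // ?; case: pselect.
Qed.

Section stieltjes_measure.
Variables (g : R -> R) (nd : nondecreasing (clamp t T g))
  (rc : right_continuous (clamp t T g)).
Let mu := lebesgue_stieltjes_measure (to_cumulative nd rc).

Lemma stieltjes_oc u v : t <= u -> u <= v -> v <= T ->
  mu `]u, v] = (g v - g u)%:E.
Proof.
move=> tu uv vT.
rewrite /mu /lebesgue_stieltjes_measure /measure_extension.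
rewrite measurable_mu_extE/=; last exact: is_ocitv.
by rewrite wlength_itv_bnd// /= !clampE//; lra.
Qed.

(** The extension by constants does not charge ]t - 1, t]. *)
Lemma stieltjes_start : mu [set t] = 0%E.
Proof.
apply/eqP; rewrite eq_le measure_ge0 andbT.
have -> : 0%E = mu `]t - 1, t].
  rewrite /mu /lebesgue_stieltjes_measure /measure_extension.
  rewrite measurable_mu_extE/=; last exact: is_ocitv.
  by rewrite wlength_itv_bnd//= ?clamp_left ?subrr//; lra.
apply: le_measure; rewrite ?inE//.
by move=> x /= ->; rewrite in_itv /=; lra.
Qed.

Lemma stieltjes_cc : mu `[t, T] = (g T - g t)%:E.
Proof.
have -> : `[t, T]%classic = [set t] `|` `]t, T].
  by rewrite setU1itv.
transitivity (mu [set t] + mu `]t, T])%E.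
  apply: measureU => //.
  by apply/seteqP; split => // x [/= ->]; rewrite in_itv /= ltxx.
by rewrite stieltjes_start add0e stieltjes_oc.
Qed.

End stieltjes_measure.

(** The set where c < l is null for dk, so an interval ]u, v] inside it has
    mass k v - k u = 0. *)
Lemma stieltjes_flat (k l : R -> R) (c : R) : {within `[t, T], continuous l} ->
  {within `[t, T], continuous k} ->
  (forall s u, t <= s -> s <= u -> u <= T -> k s <= k u) ->
  stieltjes_integral t T \1_[set s | c < l s] k = 0%E ->
  forall u v, t <= u -> u <= v -> v <= T ->
  (forall r, u < r <= v -> c < l r) -> k v = k u.
Proof.
move=> lc kc km int0 u v tu uv vT lgt.
have nd := clamp_nondecreasing km; have rc := clamp_right_continuous kc.
move: int0; rewrite (stieltjes_integralE _ nd rc).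
set mu := lebesgue_stieltjes_measure _ => int0.
pose E := `[t, T]%classic `&` [set s | c < l s].
have mE : measurable E.
  rewrite /E -[X in _ `&` X]/((fun s => c < l s) @^-1` [set true]).
  apply: (measurable_fun_ltr _ _ _) => //.
  exact: continuous_itv_measurable.
have : mu E = 0%E.
  rewrite -int0 -[in LHS](setIT E).
  rewrite [RHS](_ : _ = (\int[mu]_(s in `[t, T]) (\1_E s)%:E)%E).
    rewrite integral_indic//; congr (mu _).
    by apply/seteqP; split => x; rewrite /E /=; tauto.
  apply: eq_integral => s; rewrite inE => sT.
  congr EFin; rewrite !indicE; congr (_%:R); congr (nat_of_bool _).
  by apply/idP/idP; rewrite !inE /E //= => -[].
move=> muE; have : ((k v - k u)%:E <= mu E)%E.
  rewrite -(stieltjes_oc nd rc tu uv vT).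
  apply: le_measure; rewrite ?inE//.
  move=> r /=; rewrite in_itv /= => uvr; split; last exact: lgt.
  by rewrite /= in_itv /=; move/andP: uvr => [? ?]; apply/andP; split; lra.
rewrite muE lee_fin => h.
have := km u v tu uv vT; lra.
Qed.

End stieltjes.

Section stieltjes_ftc.
Context {R : realType}.

(** The local hypothesis says that Psi has derivative h with respect to g. On a
    short interval the integral of h and the increment of Psi both differ from
    h x * (g v - g u) by a small multiple of g v - g u, and these errors add up
    to a small multiple of g T - g t. *)
Lemma stieltjes_FTC (t T : R) (h g Psi : R -> R) : t <= T ->
  {within `[t, T], continuous h} -> {within `[t, T], continuous g} ->
  (forall s u, t <= s -> s <= u -> u <= T -> g s <= g u) ->
  (forall x e : R, t <= x <= T -> 0 < e -> exists2 d : R, 0 < d & forall u v,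
     t <= u -> x - d < u -> u <= x -> x <= v -> v < x + d -> v <= T ->
     `|Psi v - Psi u - h x * (g v - g u)| <= e * (g v - g u)) ->
  stieltjes_integral t T h g = (Psi T - Psi t)%:E.
Proof.
move=> tT hc gc gm loc.
have nd := clamp_nondecreasing tT gm; have rc := clamp_right_continuous tT gc.
rewrite (stieltjes_integralE _ nd rc); set mu := lebesgue_stieltjes_measure _.
have mh := continuous_itv_measurable hc.
have ih : mu.-integrable `[t, T] (EFin \o h).
  have [C hC] := continuous_itv_bounded hc.
  apply: (bounded_integrable (C := C)) => //.
  by have := ltry (g T - g t); rewrite -(stieltjes_cc tT nd rc).
have ihS u v : t <= u -> v <= T -> mu.-integrable `]u, v] (EFin \o h).
  move=> tu vT; apply: integrableS ih => //.
  by move=> x /=; rewrite !in_itv /= => /andP[? ?]; apply/andP; split; lra.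
have cstS (r : R) u v : t <= u -> u <= v -> v <= T ->
    mu.-integrable `]u, v] (EFin \o (fun=> r)).
  move=> tu uv vT; apply: (bounded_integrable (C := `|r|)) => //.
  by have := ltry (g v - g u); rewrite -(stieltjes_oc nd rc tu uv vT).
have cell (e : R) : 0 < e ->
    `|(\int[mu]_(s in `]t, T]) h s)%R - (Psi T - Psi t)| <= e * (g T - g t).
  move=> e0.
  (* The estimate is additive over adjacent intervals, hence only local. *)
  pose Q u v := [/\ t <= u, u <= v, v <= T &
    `|(\int[mu]_(s in `]u, v]) h s)%R - (Psi v - Psi u)| <= e * (g v - g u)].
  suff [] : Q t T by [].
  apply: itv_local_to_global => //.
    move=> u v w [tu uv vT Huv] [tv vw wT Hvw]; split => //; first lra.
    have -> : `]u, w]%classic = `]u, v]%classic `|` `]v, w]%classic.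
      by rewrite -itv_bndbnd_setU// ?bnd_simp.
    rewrite Rintegral_setU//; first last.
    - apply/disj_setPS => x [/=]; rewrite !in_itv /= => /andP[_ xv] /andP[vx _].
      by rewrite leNgt vx in xv.
    - have -> : `]u, v]%classic `|` `]v, w]%classic = `]u, w]%classic.
        by rewrite -itv_bndbnd_setU// ?bnd_simp.
      by apply: ihS.
    move: Huv Hvw.
    set I1 := (\int[mu]_(s in `]u, v]) h s)%R.
    set I2 := (\int[mu]_(s in `]v, w]) h s)%R.
    clearbody I1 I2; clear.
    by rewrite !ler_norml => /andP[? ?] /andP[? ?]; apply/andP; split; lra.
  move=> x xtT.
  have e20 : 0 < e / 2 by rewrite divr_gt0.
  have [d1 d10 H1] := loc x (e / 2) xtT e20.
  have [d2 d20 H2] := within_continuous_eps (x := x) (e := e / 2) hc xtT e20.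
  exists (Num.min d1 d2); first by rewrite lt_min d10.
  move=> u v tu xu ux xv vx vT.
  have m1 : Num.min d1 d2 <= d1 by rewrite ge_min lexx.
  have m2 : Num.min d1 d2 <= d2 by rewrite ge_min lexx orbT.
  have uv : u <= v by lra.
  split => //.
  have := H1 u v; rewrite tu ux xv vT => /(_ isT) H1'.
  have {H1'} : `|Psi v - Psi u - h x * (g v - g u)| <= e / 2 * (g v - g u).
    by clear -H1' xu vx m1; apply: H1'; lra.
  have hxy s : `]u, v]%classic s -> h x - e / 2 <= h s <= h x + e / 2.
    rewrite /= in_itv /= => /andP[us sv].
    have := H2 s; rewrite /= in_itv /= => h2.
    have /h2 {}h2 : t <= s <= T.
      by rewrite (le_trans tu (ltW us)) (le_trans sv vT).
    have /h2 : `|s - x| < d2.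
      clear -us sv xu ux xv vx m2.
      by rewrite ltr_norml; apply/andP; split; lra.
    clear; rewrite ltr_norml => /andP[? ?]; apply/andP; split; lra.
  have muE : fine (mu `]u, v]%classic) = g v - g u.
    exact: (congr1 fine (stieltjes_oc nd rc tu uv vT)).
  have lo : (h x - e / 2) * (g v - g u) <= (\int[mu]_(s in `]u, v]) h s)%R.
    rewrite -muE -Rintegral_cst//; apply: le_Rintegral => //.
    - exact: cstS.
    - exact: ihS.
    - by move=> s /hxy/andP[].
  have hi : (\int[mu]_(s in `]u, v]) h s)%R <= (h x + e / 2) * (g v - g u).
    rewrite -muE -Rintegral_cst//; apply: le_Rintegral => //.
    - exact: ihS.
    - exact: cstS.
    - by move=> s /hxy/andP[].
  move: lo hi; set I := (\int[mu]_(s in `]u, v]) h s)%R => lo hi.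
  clearbody I; clear -lo hi.
  by rewrite !ler_norml => /andP[? ?]; apply/andP; split; lra.
have IE : (\int[mu]_(s in `]t, T]) h s)%R = Psi T - Psi t.
  apply/eqP; rewrite -subr_eq0 -normr_le0; apply/ler_addgt0Pr => e e0.
  have gtT : 0 <= g T - g t by rewrite subr_ge0 gm.
  have e1 : 0 < e / (g T - g t + 1) by rewrite divr_gt0//; lra.
  apply: le_trans (cell _ e1) _; rewrite add0r.
  rewrite mulrAC ler_pdivrMr; last lra.
  by rewrite ler_wpM2l ?(ltW e0)//; lra.
have -> : `[t, T]%classic = [set t] `|` `]t, T] by rewrite setU1itv.
have mt : measurable_fun [set t] (EFin \o h).
  apply/measurable_EFinP; apply: measurable_funS mh => //.
  by move=> x /= ->; rewrite in_itv /= lexx.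
rewrite (@integral_setU _ _ _ mu [set t] `]t, T] (EFin \o h))//.
- rewrite null_set_integral//; last exact: (stieltjes_start nd rc).
  rewrite add0e -IE fineK//; apply: integrable_fin_num => //.
  exact: ihS.
- by rewrite setU1itv//; apply/measurable_EFinP.
- by apply/disj_setPS => x [/= ->]; rewrite in_itv /= ltxx.
Qed.

End stieltjes_ftc.

(** * The penalty integral along the running maximum *)

Section penalty.
Context {R : realType} (p : model R).
Hypothesis hp : standing_assumptions p.
Let lo := lfloor p.

Lemma load_rangeE x : load_range p x = (lo <= x).
Proof. by rewrite /load_range /= in_itv /= andbT. Qed.

Lemma dphi_tangent x y : lo <= x -> lo <= y ->
  dphi p x * (y - x) <= phi p y - phi p x.
Proof.
move=> lx ly; have [D _ _] := sa_phi_C2 hp.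
apply: convex_tangent.
- exact: (sa_phi_convex hp).
- by apply: D; rewrite load_rangeE.
- move=> t t0 t1; rewrite load_rangeE.
  have : 0 <= t * (y - lo) by rewrite mulr_ge0// subr_ge0.
  have : 0 <= (1 - t) * (x - lo) by rewrite mulr_ge0// subr_ge0.
  lra.
Qed.

Lemma dphi_mono x y : lo <= x -> x <= y -> dphi p x <= dphi p y.
Proof.
move=> lx xy; have ly := le_trans lx xy.
move: xy; rewrite le_eqVlt => /predU1P[->//|xy].
have h1 := dphi_tangent lx ly; have h2 := dphi_tangent ly lx.
have yx : 0 < y - x by rewrite subr_gt0.
rewrite -(ler_pM2r yx); lra.
Qed.

Lemma dphi_ge0 x : lo <= x -> 0 <= dphi p x.
Proof. by move=> lx; apply: le_trans (sa_dphi_ge0 hp) (dphi_mono _ lx). Qed.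

Lemma dphi_continuous : {within load_range p, continuous (dphi p)}.
Proof.
apply: eps_within_continuous => x e Ax e0; have [_ D _] := sa_phi_C2 hp.
exact: derivable_on_continuous (D x Ax) e0.
Qed.

(** Convexity gives dphi x <= phi (x + 1) - phi x, so that the derivative inherits
    the growth of phi. *)
Lemma phi_polynomial_growth : exists (C : R) (n : nat), 0 <= C /\
  forall x, lo <= x -> `|phi p x| <= C * (`|x| + 1) ^+ n /\
                       dphi p x <= C * (`|x| + 1) ^+ n.
Proof.
have [C [n H]] := sa_phi_growth hp.
pose C' := `|C|; have C0 : 0 <= C' := normr_ge0 C.
have H' x : lo <= x -> `|phi p x| <= 2 * C' * (`|x| + 1) ^+ n.
  move=> lx; apply: le_trans (H x lx) _.
  have a0 : 0 <= `|x| ^+ n by rewrite exprn_ge0.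
  apply: (@le_trans _ _ (C' * (1 + `|x| ^+ n))).
    by apply: ler_wpM2r; [rewrite addr_ge0|exact: ler_norm].
  rewrite -mulrA mulrCA ler_wpM2l//.
  have : 1 <= (`|x| + 1) ^+ n by rewrite exprn_ege1// lerDr.
  have : `|x| ^+ n <= (`|x| + 1) ^+ n.
    by rewrite lerXn2r ?nnegrE ?addr_ge0// lerDl.
  lra.
exists (2 * C' * (2 ^+ n + 1)), n; split.
  by rewrite mulr_ge0 ?mulr_ge0 ?addr_ge0 ?exprn_ge0.
move=> x lx; set y := `|x| + 1.
have y0 : 0 <= y by rewrite addr_ge0.
have yn0 : 0 <= y ^+ n by rewrite exprn_ge0.
have hx := H' x lx; rewrite -/y in hx.
have b0 : 0 <= 2 * C' * y ^+ n by rewrite !mulr_ge0.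
have c0 : 0 <= 2 ^+ n * (2 * C' * y ^+ n) by rewrite mulr_ge0// exprn_ge0.
have -> : 2 * C' * (2 ^+ n + 1) * y ^+ n =
    2 ^+ n * (2 * C' * y ^+ n) + 2 * C' * y ^+ n by ring.
split; first by apply: le_trans hx _; rewrite lerDr.
have lx1 : lo <= x + 1 by lra.
have := dphi_tangent lx lx1; rewrite [_ * _](_ : _ = dphi p x); last by ring.
move/le_trans; apply.
have hx1 : `|phi p (x + 1)| <= 2 ^+ n * (2 * C' * y ^+ n).
  apply: le_trans (H' _ lx1) _.
  rewrite mulrCA -exprMn ler_wpM2l ?mulr_ge0//.
  rewrite lerXn2r ?nnegrE ?mulr_ge0 ?addr_ge0//.
  have := ler_normD x 1; rewrite normr1; have := normr_ge0 x; rewrite /y; lra.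
have := ler_norm (phi p (x + 1)); have := ler_norm (- phi p x).
rewrite normrN; lra.
Qed.

End penalty.

Section running_maximum.
Context {R : realType}.
Variables (t T m : R) (L_ : R -> R).
Hypotheses (tT : t <= T) (Lc : {within `[t, T], continuous L_}).
Local Notation M := (running_max t m L_).

Lemma subitv_continuous u s : t <= u -> s <= T ->
  {within `[u, s], continuous L_}.
Proof.
move=> tu sT; apply: continuous_subspaceW Lc => r /=; rewrite !in_itv /=.
by move=> /andP[ur rs]; rewrite (le_trans tu ur) (le_trans rs sT).
Qed.

Lemma path_image_has_sup s : t <= s <= T -> has_sup [set L_ u | u in `[t, s]].
Proof.
move=> /andP[ts sT]; split.
  by exists (L_ t), t => //=; rewrite in_itv /= lexx.
have [c _ cmax] := EVT_max ts (subitv_continuous (lexx t) sT).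
by exists (L_ c) => _ [u /= us <-]; exact: cmax.
Qed.

Lemma running_max_ge_start s : m <= M s.
Proof. by rewrite le_max lexx. Qed.

Lemma running_max_ge u s : t <= u -> u <= s -> s <= T -> L_ u <= M s.
Proof.
move=> tu us sT; rewrite le_max; apply/orP; right.
have [|_ ub] := @path_image_has_sup s; first by rewrite (le_trans tu us).
by apply: ub_le_sup => //; exists u => //=; rewrite in_itv /= tu.
Qed.

Lemma running_max_le s c : t <= s -> m <= c ->
  (forall u, t <= u <= s -> L_ u <= c) -> M s <= c.
Proof.
move=> ts mc Lle; rewrite /running_max ge_max mc /=; apply: ge_sup.
  by exists (L_ t), t => //=; rewrite in_itv /= lexx.
by move=> _ [u /= us <-]; apply: Lle; rewrite in_itv in us.
Qed.

Lemma running_max_start : L_ t <= m -> M t = m.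
Proof.
move=> Lm; apply/eqP; rewrite eq_le running_max_ge_start andbT.
by apply: running_max_le => // u; rewrite -eq_le => /eqP <-.
Qed.

Lemma running_max_step u v : t <= u -> u <= v -> v <= T ->
  exists2 c, u <= c <= v & M v <= Num.max (M u) (L_ c).
Proof.
move=> tu uv vT.
have [c cuv cmax] := EVT_max uv (subitv_continuous tu vT).
rewrite in_itv /= in cuv; exists c => //.
apply: running_max_le; first exact: le_trans tu uv.
  by rewrite le_max running_max_ge_start.
move=> r /andP[tr rv]; rewrite le_max; have [ru|ur] := leP r u.
  by rewrite running_max_ge// (le_trans uv vT).
by rewrite cmax ?orbT// in_itv /= rv (ltW ur).
Qed.

Lemma running_max_mono u v : t <= u -> u <= v -> v <= T -> M u <= M v.
Proof.
move=> tu uv vT; apply: running_max_le => //; first exact: running_max_ge_start.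
by move=> r /andP[tr ru]; apply: running_max_ge => //; exact: le_trans ru uv.
Qed.

(** An increase of M can only come from the path itself; so dM is carried by the
    times at which the path equals its running maximum. *)
Lemma running_max_attained u v : t <= u -> u <= v -> v <= T -> M u < M v ->
  exists2 c, u <= c <= v & L_ c = M v.
Proof.
move=> tu uv vT Muv; have [c cuv Mc] := running_max_step tu uv vT.
exists c => //; move/andP: (cuv) => [uc cv].
apply/eqP; rewrite eq_le running_max_ge//; last exact: le_trans tu uc.
by move: Mc; rewrite le_max leNgt Muv.
Qed.

Lemma running_max_continuous : {within `[t, T], continuous M}.
Proof.
apply: eps_within_continuous => x e; rewrite /= in_itv /= => /andP[tx xT] e0.
have e20 : 0 < e / 2 by rewrite divr_gt0.
have xtT : `[t, T]%classic x by rewrite /= in_itv /= tx.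
have [d d0 H] := within_continuous_eps Lc xtT e20.
have osc u v : t <= u -> u <= v -> v <= T -> (u = x \/ v = x) ->
    v - u < d -> M v - M u < e.
  move=> tu uv vT uvx vud.
  have [le|lt] := leP (M v) (M u); first by lra.
  have [c /andP[uc cv] Lce] := running_max_attained tu uv vT lt.
  have Lu : L_ u <= M u by apply: running_max_ge => //; exact: le_trans uv vT.
  have near r : u <= r -> r <= v -> `|L_ r - L_ x| < e / 2.
    move=> ur rv; apply: H.
      by rewrite /= in_itv /= (le_trans tu ur) (le_trans rv vT).
    by rewrite ltr_norml; case: uvx => <-; apply/andP; split; lra.
  have := near c uc cv; have := near u (lexx _) uv.
  rewrite !ltr_norml => /andP[? ?] /andP[? ?]; lra.
exists d => // y; rewrite /= in_itv /= => /andP[ty yT].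
rewrite ltr_norml => /andP[yx xy]; rewrite ltr_norml.
have [le|/ltW le] := leP x y.
  have h1 : M y - M x < e by apply: osc => //; left.
  have h2 := running_max_mono tx le yT.
  by apply/andP; split; lra.
have h1 : M x - M y < e by apply: osc => //; [right|lra].
have h2 := running_max_mono ty le xT.
by apply/andP; split; lra.
Qed.

End running_maximum.

(** If M increases on a short interval around x, the load passes through the value
    M v there, so dphi (M v) is close to dphi (L_ x); so is dphi (M u), because
    L_ u <= M u <= M v. By convexity phi (M v) - phi (M u) lies between
    dphi (M u) * (M v - M u) and dphi (M v) * (M v - M u). Hence phi o M has
    derivative dphi o L_ with respect to M. *)
Lemma penalty_telescopes {R : realType} (p : model R) (t T m : R) (L_ : R -> R) :
  standing_assumptions p -> t <= T -> {within `[t, T], continuous L_} ->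
  (forall s, t <= s <= T -> lfloor p <= L_ s) -> L_ t <= m ->
  stieltjes_integral t T (dphi p \o L_) (running_max t m L_) =
  (phi p (running_max t m L_ T) - phi p m)%:E.
Proof.
move=> hp tT Lc Lfl Lm; set M := running_max t m L_.
have LM u s : t <= u -> u <= s -> s <= T -> L_ u <= M s.
  exact: running_max_ge.
have Mm u v : t <= u -> u <= v -> v <= T -> M u <= M v.
  exact: running_max_mono.
have hc : {within `[t, T], continuous (dphi p \o L_)}.
  apply: eps_within_continuous => x e xT e0.
  have Lx : load_range p (L_ x).
    by rewrite load_rangeE; apply: Lfl; rewrite /= in_itv in xT.
  have [d d0 H] := within_continuous_eps (dphi_continuous hp) Lx e0.
  have [d' d'0 H'] := within_continuous_eps Lc xT d0.
  exists d' => // y yT yx; apply: H; last exact: H'.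
  by rewrite load_rangeE; apply: Lfl; rewrite /= in_itv in yT.
have -> : phi p m = phi p (M t) by rewrite /M running_max_start.
apply: (@stieltjes_FTC _ t T _ M (phi p \o M)) => //.
  exact: running_max_continuous.
move=> x e xtT e0.
have [d d0 H] := within_continuous_eps (x := x) hc xtT e0.
exists d => // u v tu xu ux xv vx vT; rewrite /=.
have uv := le_trans ux xv; have uT := le_trans uv vT.
have := Mm u v tu uv vT; rewrite le_eqVlt => /predU1P[->|Muv].
  by rewrite !subrr mulr0 subrr normr0 mulr0.
have [c /andP[uc cv] Lce] := running_max_attained Lc tu uv vT Muv.
have near r : u <= r -> r <= v ->
    dphi p (L_ x) - e <= dphi p (L_ r) <= dphi p (L_ x) + e.
  move=> ur rv.
  have /H : `[t, T]%classic r by rewrite /= in_itv /= (le_trans tu ur) (le_trans rv vT).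
  have rx : `|r - x| < d.
    by clear -xu ux xv vx ur rv; rewrite ltr_norml; apply/andP; split; lra.
  move=> /(_ rx) /=; clear; rewrite ltr_norml => /andP[].
  by rewrite ltrBrDl => /ltW ->; rewrite ltrBlDl => /ltW ->.
have /andP[_ hi] := near c uc cv; have /andP[lw _] := near u (lexx _) uv.
have Lu : lfloor p <= L_ u by apply: Lfl; rewrite tu.
have Mu : lfloor p <= M u by apply: le_trans Lu _; apply: LM.
have Mv : lfloor p <= M v by apply: le_trans Mu (ltW Muv).
have lw' : dphi p (L_ x) - e <= dphi p (M u).
  by apply: le_trans lw _; apply: dphi_mono => //; apply: LM.
rewrite Lce -/M in hi.
have t1 := dphi_tangent hp Mu Mv; have t2 := dphi_tangent hp Mv Mu.
have D0 : 0 < M v - M u by rewrite subr_gt0.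
have h1 : (dphi p (L_ x) - e) * (M v - M u) <= phi p (M v) - phi p (M u).
  by apply: le_trans t1; rewrite ler_pM2r.
have h2 : phi p (M v) - phi p (M u) <= (dphi p (L_ x) + e) * (M v - M u).
  apply: (@le_trans _ _ (dphi p (M v) * (M v - M u))); last by rewrite ler_pM2r.
  by move: t2; rewrite -opprB mulrN lerNl opprB.
by clear -h1 h2; rewrite ler_norml; apply/andP; split; lra.
Qed.

(** * Pathwise estimates for the reflected equation *)

Section reflected_paths.
Context {R : realType} (p : model R).
Hypothesis hp : standing_assumptions p.
Variables (t : R) (W_ delta_ : R -> R).
Let T := horizon p.
Hypotheses (t0 : 0 <= t) (tT : t <= T).
Hypothesis delta_meas : measurable_fun `[t, T] delta_.
Hypothesis delta_range : forall s, t <= s <= T -> dmin p <= delta_ s <= dmax p.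

Let drift (L_ : R -> R) (u : R) : R := - lambda p * (L_ u - Theta p u) + delta_ u.

Lemma control_bounded s : t <= s <= T -> `|delta_ s| <= dmax p - dmin p.
Proof.
move=> /delta_range /andP[? ?]; have := sa_dmin hp; have := sa_dmax hp => ? ?.
by rewrite ler_norml; apply/andP; split; lra.
Qed.

Lemma itv_integrable (f : R -> R) (C : R) : measurable_fun `[t, T] f ->
  (forall s, t <= s <= T -> `|f s| <= C) ->
  lebesgue_measure.-integrable `[t, T] (EFin \o f).
Proof.
move=> mf fC.
have fin : (lebesgue_measure (`[t, T]%classic : set R) < +oo)%E.
  rewrite lebesgue_measure_itv /=; case: ifP => _; first exact: ltry.
  exact: lt0y.
exact: (bounded_integrable (C := C) _ fin).
Qed.

Lemma Theta_continuous : {within `[t, T], continuous (Theta p)}.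
Proof.
apply: continuous_subspaceW (sa_Theta_cont hp) => s /=; rewrite !in_itv /=.
by move=> /andP[ts ->]; rewrite (le_trans t0 ts).
Qed.

Lemma drift_integrable (L_ : R -> R) : {within `[t, T], continuous L_} ->
  lebesgue_measure.-integrable `[t, T] (EFin \o drift L_).
Proof.
move=> Lc; have [C LC] := continuous_itv_bounded Lc.
have [D ThD] := continuous_itv_bounded Theta_continuous.
apply: (@itv_integrable _ (lambda p * (C + D) + (dmax p - dmin p))).
  apply: measurable_funD => //; apply: measurable_funM => //.
  apply: measurable_funB.
    exact: continuous_itv_measurable.
  exact: continuous_itv_measurable Theta_continuous.
move=> s st; apply: le_trans (ler_normD _ _) _; apply: lerD.
  rewrite normrM normrN (gtr0_norm (sa_lambda hp)) ler_pM2l ?(sa_lambda hp)//.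
  by apply: le_trans (ler_normB _ _) _; apply: lerD; [exact: LC|exact: ThD].
exact: control_bounded.
Qed.

Lemma reflected_increment (l : R) (L_ k_ : R -> R) :
  reflected_path p t l W_ delta_ L_ k_ ->
  forall u s, t <= u -> u <= s -> s <= T ->
  L_ s - L_ u = (\int[lebesgue_measure]_(r in `]u, s]) drift L_ r)%R
                + sigma p * (W_ s - W_ u) + (k_ s - k_ u).
Proof.
move=> rp u s tu us sT; have ts := le_trans tu us.
rewrite (rp_equation rp (s := s)) ?ts// (rp_equation rp (s := u)); last first.
  by rewrite tu (le_trans us sT).
rewrite -(@Rintegral_itvB _ (drift L_) (BLeft t) (BRight s) u) ?bnd_simp//.
  rewrite /drift; ring.
apply: integrableS (drift_integrable (rp_L_cont rp)) => //.
by move=> r /=; rewrite !in_itv /= => /andP[-> /le_trans]; exact.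
Qed.

Lemma subitv_integrable (f : R -> R) u s : t <= u -> s <= T ->
  lebesgue_measure.-integrable `[t, T] (EFin \o f) ->
  lebesgue_measure.-integrable `]u, s] (EFin \o f).
Proof.
move=> tu sT; apply: integrableS => //.
by move=> r /=; rewrite !in_itv /= => /andP[ur rs];
  rewrite (le_trans tu (ltW ur)) (le_trans rs sT).
Qed.

Lemma reflected_start (l : R) (L_ k_ : R -> R) :
  reflected_path p t l W_ delta_ L_ k_ -> L_ t = l.
Proof.
move=> rp; rewrite (rp_equation rp) ?lexx// (rp_k_start rp).
by rewrite set_itv1 Rintegral_set1 subrr mulr0 !addr0.
Qed.

(** As long as the first load exceeds the second by more than |l - l'|, it is off
    the floor: its own reflection is idle, the reflection of the second load can
    only reduce the gap, and so does the mean reversion. The noise cancels. *)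
Lemma reflected_contraction (l l' : R) (L_ k_ L'_ k'_ : R -> R) :
  reflected_path p t l W_ delta_ L_ k_ ->
  reflected_path p t l' W_ delta_ L'_ k'_ ->
  forall s, t <= s <= T -> L_ s - L'_ s <= `|l - l'|.
Proof.
move=> rp rp' s sT; rewrite -[leRHS]addr0.
apply: (le_of_last_exit (g := fun r => L_ r - L'_ r) (a := t) (b := T)) => //.
- apply: eps_within_continuous => x e xT e0.
  have e20 : 0 < e / 2 by rewrite divr_gt0.
  have [d d0 H] := within_continuous_eps (rp_L_cont rp) xT e20.
  have [d' d'0 H'] := within_continuous_eps (rp_L_cont rp') xT e20.
  exists (Num.min d d'); first by rewrite lt_min d0.
  move=> y yT; rewrite lt_min => /andP[yd yd'].
  have -> : L_ y - L'_ y - (L_ x - L'_ x) = L_ y - L_ x - (L'_ y - L'_ x).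
    by ring.
  apply: le_lt_trans (ler_normB _ _) _.
  rewrite [ltRHS]splitr; apply: ltrD; first exact: H.
  exact: H'.
- by rewrite (reflected_start rp) (reflected_start rp') ler_norm.
move=> u v tu uv vT above.
have ord r : u < r <= v -> L'_ r < L_ r.
  by move=> /above abv; rewrite -subr_gt0; apply: le_lt_trans abv.
have uvT r : u < r <= v -> t <= r <= T.
  by move=> /andP[ur rv]; rewrite (le_trans tu (ltW ur)) (le_trans rv vT).
have kuv : k_ v = k_ u.
  apply: (stieltjes_flat tT (rp_L_cont rp) (rp_k_cont rp) (rp_k_mono rp)
    (rp_k_flat rp)) => // r ruv.
  by apply: le_lt_trans (rp_floor rp' (uvT r ruv)) (ord r ruv).
have k'uv := rp_k_mono rp' tu uv vT.
have := reflected_increment rp tu uv vT.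
have := reflected_increment rp' tu uv vT.
have : (\int[lebesgue_measure]_(r in `]u, v]) drift L_ r)%R <=
       (\int[lebesgue_measure]_(r in `]u, v]) drift L'_ r)%R.
  apply: le_Rintegral => //.
  - exact: subitv_integrable (drift_integrable (rp_L_cont rp)).
  - exact: subitv_integrable (drift_integrable (rp_L_cont rp')).
  move=> r; rewrite /= in_itv /= => ruv; rewrite /drift lerD2r.
  by rewrite ler_nM2l ?lerD2r ?(ltW (ord r ruv))// oppr_lt0 (sa_lambda hp).
rewrite kuv; move: k'uv; set I := Rintegral _ _ _; set I' := Rintegral _ _ _.
clearbody I I'; clear; lra.
Qed.

(** During an excursion above max l lo the reflection is idle, the drift is at
    most lambda (|lo| + C) + dmax since the load is at least lo, and the noise
    adds at most 2 sigma S. *)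
Lemma reflected_upper_bound (l S C : R) (L_ k_ : R -> R) :
  reflected_path p t l W_ delta_ L_ k_ ->
  (forall s : R, 0 <= s <= T -> `|W_ s - W_ 0| <= S) ->
  (forall s : R, 0 <= s <= T -> `|Theta p s| <= C) ->
  forall s, t <= s <= T ->
  L_ s <= Num.max l (lfloor p) +
    (T * (lambda p * (`|lfloor p| + C) + dmax p) + 2 * sigma p * S).
Proof.
move=> rp WS ThC s sT.
have C0 : 0 <= C by apply: le_trans (ThC 0 _); rewrite // lexx (le_trans t0).
have S0 : 0 <= S by apply: le_trans (WS 0 _); rewrite // lexx (le_trans t0).
pose B := lambda p * (`|lfloor p| + C) + dmax p.
have B0 : 0 <= B.
  by rewrite addr_ge0 ?mulr_ge0 ?addr_ge0 ?(ltW (sa_lambda hp)) ?(ltW (sa_dmax hp)).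
apply: (le_of_last_exit (g := L_) (a := t) (b := T)) => //.
- exact: rp_L_cont rp.
- by rewrite (reflected_start rp) le_max lexx.
move=> u v tu uv vT above.
have kuv : k_ v = k_ u.
  apply: (stieltjes_flat tT (rp_L_cont rp) (rp_k_cont rp) (rp_k_mono rp)
    (rp_k_flat rp)) => // r /above; apply: le_lt_trans.
  by rewrite le_max lexx orbT.
have := reflected_increment rp tu uv vT; rewrite kuv subrr addr0.
have : (\int[lebesgue_measure]_(r in `]u, v]) drift L_ r)%R <= T * B.
  apply: (@le_trans _ _ (\int[lebesgue_measure]_(r in `]u, v]) B)%R).
    apply: le_Rintegral => //.
    - exact: subitv_integrable (drift_integrable (rp_L_cont rp)).
    - apply: subitv_integrable => //; apply: (@itv_integrable _ `|B|) => //.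
    move=> r; rewrite /= in_itv /= => /andP[ur rv].
    have tr : t <= r <= T by rewrite (le_trans tu (ltW ur)) (le_trans rv vT).
    have [/andP[_ dr] fl] := (delta_range tr, rp_floor rp tr).
    rewrite /drift lerD// mulNr -mulrN ler_pM2l ?(sa_lambda hp)//.
    rewrite opprB addrC; apply: lerD.
      by rewrite -normrN (le_trans _ (ler_norm _))// lerN2.
    rewrite (le_trans (ler_norm _))// ThC// (le_trans rv vT) andbT.
    exact: le_trans t0 (le_trans tu (ltW ur)).
  rewrite Rintegral_cst// mulrC ler_wpM2r//.
  rewrite /= lebesgue_measure_itv /= lte_fin; case: ifP => _ /=; last exact: le_trans tT.
  by rewrite lerBlDr (le_trans vT)// lerDl (le_trans t0 tu).
have w1 := WS u; have w2 := WS v.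
have u0 := le_trans t0 tu; have uT := le_trans uv vT.
have v0 := le_trans u0 uv.
move: w1 w2; rewrite u0 v0 uT vT => /(_ isT) w1 /(_ isT) w2.
have : sigma p * (W_ v - W_ u) <= 2 * sigma p * S.
  rewrite (_ : 2 * sigma p * S = sigma p * (S + S)); last by ring.
  rewrite ler_pM2l ?(sa_sigma hp)// (_ : W_ v - W_ u = W_ v - W_ 0 + (W_ 0 - W_ u)).
    apply: lerD; first exact: le_trans (ler_norm _) w2.
    by rewrite (le_trans (ler_norm _))// distrC.
  by rewrite addrA subrK.
rewrite -/B; set I := Rintegral _ _ _; clearbody I; clear; lra.
Qed.

End reflected_paths.

(** * Moments of Gaussian increments *)

Section density.
Local Open Scope ereal_scope.
Context d (X : measurableType d) (R : realType).
Variables (mu nu : {measure set X -> \bar R}) (g : X -> R).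
Hypotheses (mg : measurable_fun setT g) (g0 : forall x, (0 <= g x)%R).
Hypothesis nuE : forall A, measurable A -> nu A = \int[mu]_(x in A) (g x)%:E.

Import HBNNSimple.

Let density_nnsfun (f : {nnsfun X >-> R}) :
  \int[nu]_x (f x)%:E = \int[mu]_x (f x * g x)%:E.
Proof.
under [LHS]eq_integral do rewrite fimfunE -fsumEFin//.
rewrite [LHS]ge0_integral_fsum//; last 2 first.
  - by move=> r; exact/measurable_EFinP/measurableT_comp.
  - by move=> n x _; rewrite EFinM nnfun_muleindic_ge0.
under [RHS]eq_integral.
  move=> x xD; rewrite EFinM fimfunE -fsumEFin// ge0_mule_fsuml; last first.
    by move=> r; rewrite EFinM nnfun_muleindic_ge0.
  over.
rewrite [RHS]ge0_integral_fsum//; last 2 first.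
  - move=> r; apply: emeasurable_funM; last exact/measurable_EFinP.
    by apply/measurable_EFinP; apply/measurableT_comp.
  - move=> n x _; rewrite mule_ge0 ?lee_fin//.
    by have := nnfun_muleindic_ge0 f n x; rewrite -EFinM lee_fin.
apply: eq_fsbigr => r /[!inE] -[x0 _ fx0].
have r0 : (0 <= r)%R by rewrite -fx0.
have mE : measurable (f @^-1` [set r]) by exact: measurable_funPTI.
transitivity (r%:E * nu (f @^-1` [set r])).
  under eq_integral do rewrite EFinM.
  rewrite ge0_integralZl//; last by apply/measurable_EFinP.
  by rewrite integral_indic// setIT.
rewrite nuE//.
under [RHS]eq_integral do rewrite EFinM -muleA.
rewrite [RHS]ge0_integralZl//; first last.
- by move=> x _; rewrite mule_ge0// lee_fin.
- by apply: emeasurable_funM; exact/measurable_EFinP.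
congr *%E; rewrite integral_mkcond; apply: eq_integral => x _.
by rewrite epatch_indic /= muleC.
Qed.

(** The identity holds for simple functions by additivity, and passes to f by
    monotone convergence. *)
Lemma ge0_integral_density (f : X -> \bar R) :
  measurable_fun setT f -> (forall x, 0 <= f x) ->
  \int[nu]_x f x = \int[mu]_x (f x * (g x)%:E).
Proof.
move=> mf f0; pose f_ := nnsfun_approx measurableT mf.
transitivity (lim (\int[nu]_x (f_ n x)%:E @[n --> \oo])).
  rewrite -monotone_convergence//=.
  - apply: eq_integral => ? /[!inE] xD; apply/esym/cvg_lim => //=.
    exact: cvg_nnsfun_approx.
  - by move=> n; exact/measurable_EFinP/measurable_funTS.
  - by move=> n ? _; rewrite lee_fin.
  - by move=> ? _ ? ? mn; rewrite lee_fin; exact/lefP/nd_nnsfun_approx.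
under eq_fun do rewrite density_nnsfun.
rewrite -monotone_convergence//=.
- apply: eq_integral => x /[!inE] xD; apply/cvg_lim => //=.
  under eq_fun do rewrite EFinM.
  by apply: cvgeZr => //; exact: cvg_nnsfun_approx.
- by move=> n; apply/measurable_EFinP/measurable_funM.
- by move=> n x _; rewrite lee_fin mulr_ge0.
- move=> x _ m n mn; rewrite lee_fin ler_wpM2r//.
  exact/lefP/nd_nnsfun_approx.
Qed.

End density.

Section gaussian_moments.
Context {R : realType}.

Lemma expR_dominates_power (y : R) k : 0 <= y -> y ^+ k.+1 * expR (- y) <= k.+1`!%:R.
Proof.
move=> y0; have h := expR_ge1Dxn k y0.
rewrite expRN ler_pdivrMr ?expR_gt0// mulrC -ler_pdivrMr ?ltr0n ?fact_gt0//.
by apply: le_trans h; rewrite lerDr.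
Qed.

(** Half of the Gaussian exponent beats the power, and the other half is the
    density with twice the variance, whose integral is 1. This gives the correct
    scaling in s without a change of variables. *)
Lemma normal_pdf_power (s x : R) k : 0 < s ->
  x ^+ (2 * k.+1) * normal_pdf 0 s x <=
  (4 * s ^+ 2) ^+ k.+1 * k.+1`!%:R * Num.sqrt 2 *
    normal_pdf 0 (s * Num.sqrt 2) x.
Proof.
move=> s0; have s20 : 0 < s ^+ 2 by rewrite exprn_gt0.
have q0 : 0 < Num.sqrt (2 : R) by rewrite sqrtr_gt0.
have q2 : (s * Num.sqrt 2) ^+ 2 = 2 * s ^+ 2.
  by rewrite exprMn sqr_sqrtr// mulrC.
rewrite !normal_pdfE ?gt_eqF ?mulr_gt0// /normal_fun /normal_peak q2 !subr0.
pose y := x ^+ 2 / (4 * s ^+ 2).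
have y0 : 0 <= y by rewrite divr_ge0 ?sqr_ge0// mulr_ge0// ltW.
have sn : s != 0 by rewrite gt_eqF.
have qn : Num.sqrt (2 : R) != 0 by rewrite gt_eqF.
have -> : - x ^+ 2 / (s ^+ 2 *+ 2) = - y + - y.
  rewrite /y -mulr_natr; by field.
have -> : - x ^+ 2 / (2 * s ^+ 2 *+ 2) = - y.
  rewrite /y -mulr_natr; by field.
have -> : x ^+ (2 * k.+1) = (4 * s ^+ 2) ^+ k.+1 * y ^+ k.+1.
  by rewrite -exprMn exprM /y mulrC divfK// gt_eqF// mulr_gt0.
have -> : 2 * s ^+ 2 * pi *+ 2 = 2 * (s ^+ 2 * pi *+ 2) by rewrite -mulrA mulrnAr.
rewrite sqrtrM// invfM expRD.
set q := Num.sqrt 2 in q0 qn *; set c := (Num.sqrt _)^-1.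
have c0 : 0 <= c by rewrite invr_ge0 sqrtr_ge0.
have -> : (4 * s ^+ 2) ^+ k.+1 * k.+1`!%:R * q * (q^-1 * c * expR (- y)) =
   (4 * s ^+ 2) ^+ k.+1 * c * expR (- y) * k.+1`!%:R.
  by field.
have -> : (4 * s ^+ 2) ^+ k.+1 * y ^+ k.+1 * (c * (expR (- y) * expR (- y))) =
  (4 * s ^+ 2) ^+ k.+1 * c * expR (- y) * (y ^+ k.+1 * expR (- y)) by ring.
apply: ler_wpM2l; last exact: expR_dominates_power.
by rewrite !mulr_ge0 ?expR_ge0// exprn_ge0// mulr_ge0// ltW.
Qed.

Lemma normal_moment_le (s : R) k : 0 < s ->
  (\int[lebesgue_measure]_x ((x ^+ (2 * k.+1))%:E * (normal_pdf 0 s x)%:E) <=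
   ((4 * s ^+ 2) ^+ k.+1 * k.+1`!%:R * Num.sqrt 2)%:E)%E.
Proof.
move=> s0; set c := _ * Num.sqrt 2.
have c0 : 0 <= c.
  by rewrite /c !mulr_ge0 ?sqrtr_ge0 ?ler0n// exprn_ge0// mulr_ge0// sqr_ge0.
have even_ge0 (x : R) : 0 <= x ^+ (2 * k.+1) by rewrite exprM exprn_ge0// sqr_ge0.
apply: (@le_trans _ _ (\int[lebesgue_measure]_x
    (c%:E * (normal_pdf 0 (s * Num.sqrt 2) x)%:E)))%E.
  apply: ge0_le_integral => //.
  - by move=> x _; rewrite -EFinM lee_fin mulr_ge0 ?normal_pdf_ge0.
  - apply: emeasurable_funM; apply/measurable_EFinP.
      exact: measurable_funX.
    exact: measurable_normal_pdf.
  - apply: emeasurable_funM => //; apply/measurable_EFinP.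
    exact: measurable_normal_pdf.
  - by move=> x _; rewrite -!EFinM lee_fin normal_pdf_power.
rewrite ge0_integralZl//.
- by rewrite integral_normal_pdf mule1.
- by apply/measurable_EFinP; exact: measurable_normal_pdf.
- by move=> x _; rewrite lee_fin normal_pdf_ge0.
Qed.

Lemma gaussian_even_moment d (X : measurableType d) (P : probability X R)
    (Z : X -> R) (s : R) k : measurable_fun setT Z -> 0 < s ->
  (forall B : set R, measurable B -> P (Z @^-1` B) = normal_prob 0 s B) ->
  (\int[P]_w (Z w ^+ (2 * k.+1))%:E <=
   ((4 * s ^+ 2) ^+ k.+1 * k.+1`!%:R * Num.sqrt 2)%:E)%E.
Proof.
move=> mZ s0 law; pose f (x : R) := (x ^+ (2 * k.+1))%:E.
have mf : measurable_fun setT f by apply/measurable_EFinP; exact: measurable_funX.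
have f0 x : (0 <= f x)%E by rewrite lee_fin exprM exprn_ge0// sqr_ge0.
pose Zmixin := isMeasurableFun.Build _ _ X (measurableTypeR R) Z mZ.
pose Zm : {mfun X >-> measurableTypeR R} := HB.pack Z Zmixin.
have -> : (\int[P]_w (Z w ^+ (2 * k.+1))%:E = \int[pushforward P Zm]_y f y)%E.
  by rewrite (@ge0_integral_pushforward _ _ X (measurableTypeR R) R Z mZ P setT f).
rewrite (@ge0_integral_density _ (measurableTypeR R) R lebesgue_measure
  (pushforward P Zm) (normal_pdf 0 s) _ _ _ f)//.
- exact: normal_moment_le.
- exact: measurable_normal_pdf.
- exact: normal_pdf_ge0.
Qed.

End gaussian_moments.

(** * Moments of the supremum of Brownian motion *)

Section chaining.
Context {R : realType}.

(** A node of level n + 1 either belongs to level n, when its index is even, or is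
    one jump of level n + 1 away from the node just before it, which does. *)
Lemma dyadic_chaining (f : R -> R) (T : R) (A : nat -> R) :
  (forall j, 0 <= A j) ->
  (forall j i, (i < 2 ^ j)%N ->
     `|f (i.+1%:R * T / 2 ^+ j) - f (i%:R * T / 2 ^+ j)| <= A j) ->
  forall n i, (i <= 2 ^ n)%N ->
    `|f (i%:R * T / 2 ^+ n) - f 0| <= \sum_(j < n.+1) A j.
Proof.
move=> A0 H; elim=> [|n IH] i i2n.
  rewrite big_ord_recl big_ord0 addr0; move: i2n; rewrite expn0.
  case: i => [|[|//]] _; first by rewrite !mul0r subrr normr0.
  by have := H 0%N 0%N isT; rewrite !mul0r.
rewrite big_ord_recr /=.
have half (j : nat) : (j.*2)%:R * T / 2 ^+ n.+1 = j%:R * T / 2 ^+ n.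
  by rewrite -muln2 natrM exprS; field; rewrite expf_neq0.
rewrite -(odd_double_half i) in i2n *; case: (odd i) i2n => /=.
  rewrite add1n expnS mul2n => i2n.
  have hn : (i./2 < 2 ^ n)%N by rewrite -ltn_double.
  rewrite (_ : _ - f 0 = (f ((i./2).*2.+1%:R * T / 2 ^+ n.+1) -
     f ((i./2).*2%:R * T / 2 ^+ n.+1)) +
     (f ((i./2).*2%:R * T / 2 ^+ n.+1) - f 0)); last by ring.
  apply: le_trans (ler_normD _ _) _; rewrite [leRHS]addrC; apply: lerD.
    by apply: H; rewrite expnS mul2n.
  by rewrite half; apply: IH; exact: ltnW.
rewrite add0n expnS mul2n leq_double half => i2n.
by apply: le_trans (IH _ i2n) _; rewrite lerDl.
Qed.

Lemma dyadic_approximation (T s d : R) : 0 < T -> 0 <= s <= T -> 0 < d ->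
  exists n i, [/\ (i <= 2 ^ n)%N, 0 <= i%:R * T / 2 ^+ n <= T &
    `|i%:R * T / 2 ^+ n - s| < d].
Proof.
move=> T0 /andP[s0 sT] d0.
pose n := Num.bound (T / d).
have n2 : T / 2 ^+ n < d.
  rewrite ltr_pdivrMr ?exprn_gt0// mulrC -ltr_pdivrMr//.
  apply: lt_trans (_ : n%:R < _).
    by apply: archi_boundP; rewrite divr_ge0 ?ltW.
  by rewrite -natrX ltr_nat ltn_expl.
have p0 : 0 < 2 ^+ n / T :> R by rewrite divr_gt0// exprn_gt0.
pose i := Num.truncn (s * (2 ^+ n / T)).
have x0 : 0 <= s * (2 ^+ n / T) by rewrite mulr_ge0// ltW.
have /andP[lo hi] := truncn_itv x0.
have E (a : R) : a * T / 2 ^+ n = a / (2 ^+ n / T).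
  by rewrite invfM invrK mulrA mulrAC.
have is_ : i%:R * T / 2 ^+ n <= s by rewrite E ler_pdivrMr.
have si : s < i%:R * T / 2 ^+ n + T / 2 ^+ n.
  rewrite (_ : _ + _ = i.+1%:R * T / 2 ^+ n); first by rewrite E ltr_pdivlMr.
  by rewrite -natr1; ring.
exists n, i; split.
- rewrite -(ler_nat R) natrX (le_trans lo)// mulrCA ler_piMr ?exprn_ge0//.
  by rewrite ler_pdivrMr// mul1r.
- rewrite (le_trans is_ sT) andbT divr_ge0 ?exprn_ge0//.
  by rewrite mulr_ge0 ?ler0n ?(ltW T0).
- by clear -n2 is_ si; rewrite ltr_norml; apply/andP; split; lra.
Qed.

Lemma dyadic_sup_bound (f : R -> R) (T S : R) : 0 < T ->
  {within `[0, T], continuous f} ->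
  (forall n i, (i <= 2 ^ n)%N -> `|f (i%:R * T / 2 ^+ n) - f 0| <= S) ->
  forall s, 0 <= s <= T -> `|f s - f 0| <= S.
Proof.
move=> T0 fc H s sT; apply/ler_addgt0Pr => e e0.
have [d d0 Hd] := within_continuous_eps (x := s) fc sT e0.
have [n [i [i2n iT id_]]] := dyadic_approximation T0 sT d0.
have h1 := H n i i2n; have /ltW h2 := Hd _ iT id_.
rewrite (_ : f s - f 0 = (f (i%:R * T / 2 ^+ n) - f 0) -
  (f (i%:R * T / 2 ^+ n) - f s)); last by ring.
by rewrite (le_trans (ler_normB _ _))// lerD.
Qed.

Lemma geometric_sum_le (r : R) n : 0 <= r < 1 ->
  \sum_(j < n) r ^+ j <= (1 - r)^-1.
Proof.
move=> /andP[r0 r1]; have r1' : 0 < 1 - r by rewrite subr_gt0.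
rewrite -(ler_pM2l r1') divff ?gt_eqF// -opprB mulNr -subrX1 opprB.
by rewrite lerBlDr lerDl exprn_ge0.
Qed.

End chaining.

Section brownian_supremum.
Context {R : realType} d (Omega : measurableType d) (P : probability Omega R).
Variables (T : R) (F : R -> set (set Omega)) (W : R -> Omega -> R).
Hypotheses (T0 : 0 < T) (hF : usual_conditions T P F)
  (hW : brownian_motion T P F W).

Lemma brownian_measurable s : 0 <= s <= T -> measurable_fun setT (W s).
Proof.
move=> sT _ B mB; have := bm_adapted hW sT measurableT mB.
apply: smallest_sub; first exact: sigma_algebra_measurable.
exact: (uc_measurable hF sT).
Qed.

Lemma increment_even_moment s u k : 0 <= s -> s < u -> u <= T ->
  (\int[P]_w ((W u w - W s w) ^+ (2 * k.+1))%:E <=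
   ((4 * (u - s)) ^+ k.+1 * k.+1`!%:R * Num.sqrt 2)%:E)%E.
Proof.
move=> s0 su uT; have us0 : 0 < u - s by rewrite subr_gt0.
rewrite -[u - s in leRHS]sqr_sqrtr ?(ltW us0)//.
apply: gaussian_even_moment.
- apply: measurable_funB; apply: brownian_measurable.
    by rewrite uT (le_trans s0 (ltW su)).
  by rewrite s0 (le_trans (ltW su) uT).
- by rewrite sqrtr_gt0.
- by move=> B mB; exact: (bm_gaussian hW s0 su uT mB).
Qed.

Let node (j i : nat) : R := i%:R * T / 2 ^+ j.
Let jump (j i : nat) (w : Omega) : R := W (node j i.+1) w - W (node j i) w.

Let node_itv j i : (i <= 2 ^ j)%N -> 0 <= node j i <= T.
Proof.
move=> ij; rewrite /node divr_ge0 ?exprn_ge0 ?mulr_ge0 ?ler0n ?(ltW T0)//=.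
by rewrite ler_pdivrMr ?exprn_gt0// mulrC ler_pM2l// -natrX ler_nat.
Qed.

Let jump_measurable j i : (i < 2 ^ j)%N -> measurable_fun setT (jump j i).
Proof.
move=> ij; apply: measurable_funB; apply: brownian_measurable; apply: node_itv => //.
exact: ltnW.
Qed.

Variable k : nat.
Hypothesis k1 : (1 <= k)%N.
Let q := k.+1.
(** Any ratio in ](1/2)^(1/4), 1[ would do; see theta below. *)
Let ratio : R := 9 / 10.
(** The weight is such that, if the sum G of all levels is finite, the jumps of
    level j are at most a constant times ratio ^+ j, which is summable over j. *)
Let level (j : nat) (w : Omega) : R :=
  (ratio ^+ (2 * q)) ^- j * \sum_(i < 2 ^ j) jump j i w ^+ (2 * q).
Let G (w : Omega) : \bar R := (\sum_(j <oo) (level j w)%:E)%E.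

Let ratio_gt0 : 0 < ratio. Proof. by rewrite divr_gt0. Qed.

Let even_ge0 (x : R) : 0 <= x ^+ (2 * q).
Proof. by rewrite exprM exprn_ge0// sqr_ge0. Qed.

Let level_ge0 j w : 0 <= level j w.
Proof.
by rewrite mulr_ge0 ?sumr_ge0// invr_ge0 exprn_ge0// exprn_ge0// ltW.
Qed.

Let level_measurable j : measurable_fun setT (level j).
Proof.
apply: measurable_funM => //; apply: measurable_sum => i.
by apply: measurable_funX; apply: jump_measurable.
Qed.

(** Level j has 2 ^+ j jumps, each with a moment of order 2 q that is
    proportional to (2 ^+ q) ^- j; theta is the resulting growth factor of the
    mean of the weighted level. It is below 1 because q is at least 2. *)
Let theta : R := 2 * (ratio ^+ (2 * q))^-1 / 2 ^+ q.

Let theta_lt1 : 0 <= theta < 1.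
Proof.
have r0 := ratio_gt0.
apply/andP; split; first by rewrite !mulr_ge0 ?invr_ge0 ?exprn_ge0 ?(ltW r0).
rewrite /theta exprM -mulrA -invfM -exprMn /q.
(* theta = 2 / (81 / 50) ^+ q, and 2 < (81 / 50) ^+ 2 *)
have -> : ratio ^+ 2 * 2 = 81 / 50 by rewrite /ratio; field.
have -> : (81 / 50 : R) ^+ k.+1 = (81 / 50) ^+ k.-1 * ((81 / 50) ^+ 2).
  by rewrite -exprD; congr (_ ^+ _); lia.
have b1 : 1 <= (81 / 50 : R) ^+ k.-1 by rewrite exprn_ege1//; lra.
rewrite ltr_pdivrMr; last by rewrite mulr_gt0 ?exprn_gt0//; lra.
rewrite mul1r; apply: (@lt_le_trans _ _ (1 * (81 / 50) ^+ 2)); first by lra.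
by rewrite ler_wpM2r// exprn_ge0//; lra.
Qed.

Let level_integral j : (\int[P]_w (level j w)%:E <=
   ((4 * T) ^+ q * q`!%:R * Num.sqrt 2 * theta ^+ j)%:E)%E.
Proof.
have w0 : 0 <= (ratio ^+ (2 * q)) ^- j.
  by rewrite invr_ge0 exprn_ge0// exprn_ge0// ltW.
under eq_integral do rewrite EFinM -sumEFin.
rewrite ge0_integralZl//; last 2 first.
- by apply: emeasurable_sum => i; apply/measurable_EFinP/measurable_funX/jump_measurable.
- by move=> w _; apply: sume_ge0 => i _; rewrite lee_fin.
rewrite ge0_integral_sum//; last 2 first.
- by move=> i; apply/measurable_EFinP/measurable_funX/jump_measurable.
- by move=> i w _; rewrite lee_fin.
pose c : R := q`!%:R * Num.sqrt 2.
apply: (@le_trans _ _ (((ratio ^+ (2 * q)) ^- j)%:E *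
    \sum_(i < 2 ^ j) ((4 * (T / 2 ^+ j)) ^+ q * c)%:E)%E).
  apply: lee_wpmul2l; first by rewrite lee_fin.
  apply: lee_sum => i _.
  have /andP[n0 _] := node_itv (ltnW (ltn_ord i)).
  have /andP[_ nT] := node_itv (ltn_ord i).
  have E : node j i.+1 - node j i = T / 2 ^+ j.
    by rewrite /node -natr1; ring.
  have lt : node j i < node j i.+1.
    by rewrite -subr_gt0 E divr_gt0// exprn_gt0.
  have := increment_even_moment k n0 lt nT.
  by rewrite E -mulrA.
rewrite sumEFin sumr_const card_ord -EFinM lee_fin.
have mulX (x : R) : x *+ 2 ^ j = 2 ^+ j * x by rewrite -[LHS]mulr_natl natrX.
rewrite mulX.
have -> : (4 * (T / 2 ^+ j)) ^+ q = (4 * T) ^+ q * (2 ^+ q)^-1 ^+ j.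
  by rewrite mulrA exprMn !exprVn -!exprM mulnC.
have -> : theta ^+ j = 2 ^+ j * (ratio ^+ (2 * q)) ^- j * (2 ^+ q)^-1 ^+ j.
  have powM (x y z : R) : (x * y * z) ^+ j = x ^+ j * y ^+ j * z ^+ j.
    by rewrite !exprMn.
  by rewrite /theta powM [(_ ^+ (2 * q))^-1 ^+ j]exprVn.
rewrite le_eqVlt; apply/orP; left; apply/eqP; rewrite /c.
move: (_ ^- j) (_^-1 ^+ j) (2 ^+ j) (_ ^+ q) q`!%:R (Num.sqrt 2) => *; ring.
Qed.

Let G_integral : (\int[P]_w G w < +oo)%E.
Proof.
rewrite integral_nneseries//; last 2 first.
- by move=> j; apply/measurable_EFinP; exact: level_measurable.
- by move=> j w _; rewrite lee_fin.
pose c : R := (4 * T) ^+ q * q`!%:R * Num.sqrt 2.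
have c0 : 0 <= c.
  by rewrite /c !mulr_ge0 ?sqrtr_ge0 ?ler0n ?exprn_ge0 ?mulr_ge0 ?(ltW T0).
apply: (@le_lt_trans _ _ (c / (1 - theta))%:E); last exact: ltry.
apply: lime_le.
  by apply: is_cvg_nneseries => j _ _; apply: integral_ge0 => w _; rewrite lee_fin.
apply: nearW => n; apply: (@le_trans _ _ (\sum_(0 <= j < n) (c * theta ^+ j)%:E)%E).
  by apply: lee_sum => j _; exact: level_integral.
rewrite sumEFin lee_fin -mulr_sumr big_mkord ler_wpM2l//.
exact: geometric_sum_le theta_lt1.
Qed.

Let G_controls_path w : {within `[0, T], continuous (W^~ w)} ->
  (G w < +oo)%E ->
  exists S, [/\ 0 <= S, forall s, 0 <= s <= T -> `|W s w - W 0 w| <= S &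
    ((S ^+ (2 * q))%:E <= (10 ^+ (2 * q))%:E * G w)%E].
Proof.
move=> Wc Gfin; have lev0 j : (0 <= (level j w)%:E)%E by rewrite lee_fin.
have G0 : (0 <= G w)%E by apply: nneseries_ge0.
have [g g0 GE] : exists2 g : R, 0 <= g & G w = g%:E.
  exists (fine (G w)); first exact: fine_ge0.
  by rewrite fineK// ge0_fin_numE.
(* y bounds the jumps of level j up to the factor ratio ^+ j, and
   1 / (1 - ratio) = 10. *)
pose y := g `^ (2 * q)%:R^-1.
have yE : y ^+ (2 * q) = g.
  by rewrite -powR_mulrn ?powR_ge0// -powRrM mulVf ?powRr1// pnatr_eq0.
have y0 : 0 <= y by exact: powR_ge0.
have jump_le j i : (i < 2 ^ j)%N -> `|jump j i w| <= y * ratio ^+ j.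
  move=> ij; have lg : level j w <= g.
    rewrite -lee_fin -GE; apply: le_trans (nneseries_lim_ge j.+1 _) => //.
    by rewrite big_nat_recr//= leeDr// sume_ge0.
  rewrite -(@ler_pXn2r _ (2 * q)) ?nnegrE ?mulr_ge0 ?exprn_ge0 ?(ltW ratio_gt0)//.
  rewrite -normrX ger0_norm// exprMn yE exprAC.
  rewrite -ler_pdivrMr ?exprn_gt0 ?exprn_gt0//; apply: le_trans lg.
  rewrite [leLHS]mulrC /level ler_wpM2l//.
    by rewrite invr_ge0 exprn_ge0// exprn_ge0// ltW.
  by rewrite (bigD1 (Ordinal ij))//= lerDl sumr_ge0.
exists (10 * y); split; first by rewrite mulr_ge0.
  apply: (@dyadic_sup_bound _ (W^~ w)) => // n i i2n.
  have := @dyadic_chaining _ (W^~ w) T (fun j => y * ratio ^+ j) _ jump_le n i i2n.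
  move=> H; apply: le_trans (H _) _.
    by move=> j; rewrite mulr_ge0// exprn_ge0// ltW.
  rewrite -mulr_sumr mulrC ler_wpM2r//.
  have r01 : 0 <= ratio < 1 by rewrite /ratio; apply/andP; split; lra.
  apply: le_trans (geometric_sum_le _ r01) _; rewrite le_eqVlt.
  by apply/orP; left; apply/eqP; rewrite /ratio; field.
by rewrite GE -EFinM lee_fin exprMn yE.
Qed.

Lemma brownian_sup_even_moment : exists H : Omega -> \bar R,
  [/\ measurable_fun setT H, forall w, (0 <= H w)%E, (\int[P]_w H w < +oo)%E &
   {ae P, forall w, exists S : R, [/\ 0 <= S,
     forall s : R, 0 <= s <= T -> `|W s w - W 0 w| <= S &
     (((1 + S) ^+ (2 * q))%:E <= H w)%E]}].
Proof.
have Gm : measurable_fun setT G.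
  apply: ge0_emeasurable_sum => [j w _ _|j _]; first by rewrite lee_fin.
  by apply/measurable_EFinP; exact: level_measurable.
have G0 w : (0 <= G w)%E by apply: nneseries_ge0 => j _ _; rewrite lee_fin.
pose a : R := 2 ^+ (2 * q).
have a0 : 0 <= a by rewrite exprn_ge0.
have b0 : 0 <= (10 : R) ^+ (2 * q) by rewrite exprn_ge0.
exists (fun w => a%:E * (1 + (10 ^+ (2 * q))%:E * G w))%E; split.
- by apply: emeasurable_funM => //; apply: emeasurable_funD => //;
  apply: emeasurable_funM.
- by move=> w; rewrite mule_ge0 ?lee_fin// adde_ge0// mule_ge0 ?lee_fin.
- rewrite ge0_integralZl//; last 2 first.
  + by apply: emeasurable_funD => //; apply: emeasurable_funM.
  + by move=> w _; rewrite adde_ge0// mule_ge0 ?lee_fin.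
  rewrite ge0_integralD//; last 2 first.
  + by move=> w _; rewrite mule_ge0 ?lee_fin.
  + by apply: emeasurable_funM.
  rewrite integral_cst//= probability_setT mule1 ge0_integralZl//.
  rewrite lte_mul_pinfty// lte_add_pinfty// ?ltry//.
  by rewrite lte_mul_pinfty.
- apply: filterS (bm_continuous hW) => w Wc.
  (* Where G is infinite, so is the majorant, and any bound of the continuous
     path will do. *)
  have [Gfin|] := ltP (G w) +oo%E; last first.
    rewrite leye_eq => /eqP Gy.
    have [C HC] := continuous_itv_bounded Wc.
    exists (C + C); split.
    + by rewrite addr_ge0// (le_trans (normr_ge0 (W 0 w)))// HC// lexx ltW.
    + move=> s sT; rewrite (le_trans (ler_normB _ _))// lerD//; apply: HC => //.
      by rewrite lexx ltW.
    + rewrite Gy gt0_muley ?lte_fin ?exprn_gt0// addey// gt0_muley ?leey//.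
      by rewrite lte_fin exprn_gt0.
  have [S [S0 WS SG]] := G_controls_path Wc Gfin.
  exists S; split => //.
  apply: (@le_trans _ _ (a%:E * (1 + (S ^+ (2 * q))%:E)%E)%E).
    rewrite -EFinD -EFinM lee_fin.
    have [S1|/ltW S1] := leP S 1.
      apply: (@le_trans _ _ a).
        by rewrite lerXn2r ?nnegrE ?addr_ge0//; lra.
      by rewrite ler_peMr// lerDl exprn_ge0.
    apply: (@le_trans _ _ (a * S ^+ (2 * q))).
      by rewrite -exprMn lerXn2r ?nnegrE ?addr_ge0 ?mulr_ge0//; lra.
    by rewrite ler_wpM2l// lerDr.
  by rewrite lee_wpmul2l ?lee_fin// leeD2l.
Qed.

End brownian_supremum.

(** Kolmogorov's chaining bound. The supremum of the path enters through a bound S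
    chosen path by path, so that only the majorant H has to be measurable. *)
Lemma brownian_sup_moment {R : realType} d (Omega : measurableType d)
    (P : probability Omega R) (T : R) (F : R -> set (set Omega))
    (W : R -> Omega -> R) (n : nat) :
  0 < T -> usual_conditions T P F -> brownian_motion T P F W ->
  exists H : Omega -> \bar R,
  [/\ measurable_fun setT H, forall w, (0 <= H w)%E, (\int[P]_w H w < +oo)%E &
   {ae P, forall w, exists S : R, [/\ 0 <= S,
     forall s : R, 0 <= s <= T -> `|W s w - W 0 w| <= S &
     (((1 + S) ^+ n)%:E <= H w)%E]}].
Proof.
move=> T0 hF hW.
have [H [mH H0 Hfin HS]] := brownian_sup_even_moment T0 hF hW (isT : (1 <= n.+1)%N).
exists H; split => //; apply: filterS HS => w [S [S0 WS SH]].
exists S; split => //; apply: le_trans SH; rewrite lee_fin.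
by rewrite ler_weXn2l// ?lerDl//; lia.
Qed.

(** * Integrals of functions that need not be measurable, and infima *)

Section unmeasurable_integrands.
Local Open Scope ereal_scope.
Context d (X : measurableType d) (R : realType) (mu : {measure set X -> \bar R}).
Implicit Types (f g Z : X -> \bar R).

Import HBNNSimple.

(** The integral of a nonnegative function, measurable or not, is a supremum over
    the simple functions below it. *)
Lemma ge0_le_integral_unmeasurable f g :
  (forall x, 0 <= f x) -> (forall x, f x <= g x) ->
  \int[mu]_x f x <= \int[mu]_x g x.
Proof.
move=> f0 fg; have g0 x : 0 <= g x by apply: le_trans (f0 x) (fg x).
rewrite !ge0_integralTE//; apply: le_ereal_sup => _ [h /= hf <-].
by exists h => // x; apply: le_trans (hf x) (fg x).
Qed.

(** Lower integrals are not subadditive in general, but they are when one summand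
    is measurable: if h is a simple function below f, then the positive part of
    h - Z is measurable and lies below g. *)
Lemma ge0_le_integralD_ae f g Z :
  (forall x, 0 <= f x) -> (forall x, 0 <= g x) -> (forall x, 0 <= Z x) ->
  measurable_fun setT Z -> {ae mu, forall x, f x <= g x + Z x} ->
  \int[mu]_x f x <= \int[mu]_x g x + \int[mu]_x Z x.
Proof.
move=> f0 g0 Z0 mZ [N [mN N0 fgN]].
rewrite (ge0_integralTE mu f0); apply: ge_ereal_sup => _ [h /= hf <-].
pose u := ((EFin \o h) \- Z)^\+ \_ (~` N).
have mNC : measurable (~` N) by exact: measurableC.
have u0 x : 0 <= u x.
  by rewrite /u patchE; case: ifP => // _; exact: funepos_ge0.
have mh : measurable_fun setT (EFin \o h) by apply/measurable_EFinP.
have mu_ : measurable_fun setT u.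
  apply/(measurable_restrictT _ mNC); apply: measurable_funTS.
  by apply: measurable_funepos; apply: emeasurable_funB.
have ug x : u x <= g x.
  rewrite /u patchE; case: ifPn => // xN.
  have fx : f x <= g x + Z x.
    apply: contrapT => nfx; move: xN; rewrite inE; apply; exact: fgN.
  rewrite funeposE /= ge_max g0 andbT; move: fx (hf x) (Z0 x).
  case: (Z x) => [z|_ _ _|//]; last by rewrite addeNy ?leNye.
  by move=> fx hfx _; rewrite leeBlDr//; apply: le_trans hfx fx.
rewrite -integralT_nnsfun.
apply: (@le_trans _ _ (\int[mu]_x (u x + Z x))); last first.
  rewrite ge0_integralD// leeD2r//.
  exact: ge0_le_integral_unmeasurable.
apply: ae_ge0_le_integral => //.
- by move=> x _; rewrite lee_fin.
- by move=> x _; rewrite adde_ge0.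
- exact: emeasurable_funD.
exists N; split=> // x /= xh; apply: contrapT => xN; apply: xh => _.
rewrite /u patchE mem_set// funeposE.
have hx : 0 <= (h x)%:E by rewrite lee_fin.
move: (Z0 x); case: (Z x) => [z|_|//]; last first.
  by rewrite addey ?leey// -ltNye lt_max ltNyr orbT.
move=> _; rewrite -leeBlDr// le_max lexx//.
Qed.

Lemma parts_distance_ae (f g : X -> R) Z :
  (forall x, 0 <= Z x) -> measurable_fun setT Z ->
  {ae mu, forall x, `|f x - g x|%:E <= Z x} ->
  \int[mu]_x (EFin \o f)^\+ x <= \int[mu]_x (EFin \o g)^\+ x + \int[mu]_x Z x /\
  \int[mu]_x (EFin \o f)^\- x <= \int[mu]_x (EFin \o g)^\- x + \int[mu]_x Z x.
Proof.
move=> Z0 mZ fgZ; split; apply: ge0_le_integralD_ae => //;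
    apply: filterS fgZ => x; rewrite ?funeposE ?funenegE /=;
    move: (Z0 x); case: (Z x) => [z|_ _|//].
- rewrite -!EFin_max -EFinD !lee_fin ler_norml => z0 /andP[h1 h2].
  by rewrite ge_max; case: (leP (g x) 0%R) => ?; apply/andP; split; lra.
- by rewrite addey ?leey// -ltNye lt_max !ltNyr.
- rewrite -!EFin_max -EFinD !lee_fin ler_norml => z0 /andP[h1 h2].
  by rewrite ge_max; case: (leP (- g x)%R 0%R) => ?; apply/andP; split; lra.
- by rewrite addey ?leey// -ltNye lt_max !ltNyr.
Qed.

Section dominated.
Variables (f : X -> R) (Z : X -> \bar R).
Hypotheses (Z0 : forall x, 0 <= Z x) (mZ : measurable_fun setT Z)
  (fZ : {ae mu, forall x, `|f x|%:E <= Z x}) (Zoo : \int[mu]_x Z x < +oo).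

Lemma parts_dominated_ae :
  \int[mu]_x (EFin \o f)^\+ x <= \int[mu]_x Z x /\
  \int[mu]_x (EFin \o f)^\- x <= \int[mu]_x Z x.
Proof.
have fZ' : {ae mu, forall x, `|f x - cst 0%R x|%:E <= Z x}.
  by apply: filterS fZ => x; rewrite subr0.
have [] := parts_distance_ae Z0 mZ fZ'.
rewrite (_ : (EFin \o cst 0%R)^\+ = cst 0); last first.
  by apply/funext => x; rewrite funeposE /= maxxx.
rewrite (_ : (EFin \o cst 0%R)^\- = cst 0); last first.
  by apply/funext => x; rewrite funenegE /= oppr0 maxxx.
by rewrite integral0 add0e.
Qed.

Lemma parts_fin_num_ae : \int[mu]_x (EFin \o f)^\+ x \is a fin_num /\
  \int[mu]_x (EFin \o f)^\- x \is a fin_num.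
Proof.
have [pos neg] := parts_dominated_ae.
by rewrite !ge0_fin_numE ?integral_ge0// (le_lt_trans pos) ?(le_lt_trans neg).
Qed.

Lemma integral_dominated_ae :
  \int[mu]_x (f x)%:E \is a fin_num /\
  `|\int[mu]_x (f x)%:E| <= \int[mu]_x Z x + \int[mu]_x Z x.
Proof.
have [pos neg] := parts_dominated_ae; have [pfin nfin] := parts_fin_num_ae.
rewrite integralE; split; first by rewrite fin_numB pfin.
apply: le_trans (lee_abs_sub _ _) _.
by rewrite !gee0_abs ?integral_ge0// leeD.
Qed.

End dominated.

(** The factor 2 comes from comparing the positive and the negative parts
    separately. The integrable majorant Z' excludes differences of infinities. *)
Lemma integral_distance_ae (f g : X -> R) Z Z' :
  (forall x, 0 <= Z x) -> measurable_fun setT Z -> \int[mu]_x Z x < +oo ->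
  (forall x, 0 <= Z' x) -> measurable_fun setT Z' -> \int[mu]_x Z' x < +oo ->
  {ae mu, forall x, `|f x|%:E <= Z' x} -> {ae mu, forall x, `|g x|%:E <= Z' x} ->
  {ae mu, forall x, `|f x - g x|%:E <= Z x} ->
  `|\int[mu]_x (f x)%:E - \int[mu]_x (g x)%:E|
    <= \int[mu]_x Z x + \int[mu]_x Z x.
Proof.
move=> Z0 mZ Zoo Z'0 mZ' Z'oo fZ gZ fgZ.
have gfZ : {ae mu, forall x, `|g x - f x|%:E <= Z x}.
  by apply: filterS fgZ => x; rewrite distrC.
have [fp fn] := parts_distance_ae Z0 mZ fgZ.
have [gp gn] := parts_distance_ae Z0 mZ gfZ.
have [fpf fnf] := parts_fin_num_ae Z'0 mZ' fZ Z'oo.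
have [gpf gnf] := parts_fin_num_ae Z'0 mZ' gZ Z'oo.
have zf : \int[mu]_x Z x \is a fin_num by rewrite ge0_fin_numE// integral_ge0.
move: fp fn gp gn; rewrite !(integralE mu setT (fun x => (_ x)%:E)).
rewrite -(fineK fpf) -(fineK fnf) -(fineK gpf) -(fineK gnf) -(fineK zf).
rewrite -!EFinD /= !lee_fin; clear.
by rewrite ler_norml => *; apply/andP; split; lra.
Qed.

End unmeasurable_integrands.

Section infimum_distance.
Context {R : realType} {I : Type} (A : set I).
Variables (f g : I -> R) (b : R).

Lemma ereal_inf_finite : A !=set0 -> (forall i, A i -> `|f i| <= b) ->
  ereal_inf [set (f i)%:E | i in A] \is a fin_num.
Proof.
move=> [i Ai] fb; rewrite fin_numE; apply/andP; split.
  have : (((- b)%:E <= ereal_inf [set (f i)%:E | i in A])%E).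
    apply: le_ereal_inf_tmp => _ [j Aj <-]; rewrite lee_fin.
    by have := fb j Aj; rewrite ler_norml => /andP[].
  by apply: contraTneq => ->; rewrite leeNy_eq.
have : (ereal_inf [set (f i)%:E | i in A] <= (f i)%:E)%E.
  by apply: ereal_inf_lbound; exists i.
by apply: contraTneq => ->; rewrite leye_eq.
Qed.

Lemma ereal_inf_le_shift c : (forall i, A i -> f i <= g i + c) ->
  (ereal_inf [set (f i)%:E | i in A] <= ereal_inf [set (g i)%:E | i in A] + c%:E)%E.
Proof.
move=> fg; rewrite -leeBlDr//; apply: le_ereal_inf_tmp => _ [i Ai <-].
rewrite leeBlDr// -EFinD; apply: (@le_trans _ _ (f i)%:E); last first.
  by rewrite lee_fin; exact: fg.
by apply: ereal_inf_lbound; exists i.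
Qed.

End infimum_distance.

Lemma ereal_inf_distance {R : realType} {I : Type} (A : set I) (f g : I -> R)
    (b c : R) : A !=set0 ->
  (forall i, A i -> `|f i| <= b) -> (forall i, A i -> `|g i| <= b) ->
  (forall i, A i -> `|f i - g i| <= c) ->
  (`|ereal_inf [set (f i)%:E | i in A] - ereal_inf [set (g i)%:E | i in A]|
    <= c%:E)%E.
Proof.
move=> A0 fb gb fgc.
have h1 : (ereal_inf [set (f i)%:E | i in A] <=
           ereal_inf [set (g i)%:E | i in A] + c%:E)%E.
  apply: ereal_inf_le_shift => i Ai; rewrite -lerBlDl.
  exact: le_trans (ler_norm _) (fgc i Ai).
have h2 : (ereal_inf [set (g i)%:E | i in A] <=
           ereal_inf [set (f i)%:E | i in A] + c%:E)%E.
  apply: ereal_inf_le_shift => i Ai; rewrite -lerBlDl.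
  by apply: le_trans (ler_norm _) _; rewrite distrC; exact: fgc.
move: h1 h2; rewrite -(fineK (ereal_inf_finite A0 fb)) -(fineK (ereal_inf_finite A0 gb)).
rewrite -!EFinD /= !lee_fin => h1 h2.
by rewrite ler_norml; apply/andP; split; lra.
Qed.

(** * Regularity of the path cost *)

Lemma progressive_path_measurable {R : realType} d (Omega : measurableType d)
    (T t : R) (F : R -> set (set Omega)) (delta : R -> Omega -> R) (w : Omega) :
  t <= T -> progressive T F t delta -> measurable_fun `[t, T] (delta^~ w).
Proof.
move=> tT /(_ T); rewrite tT lexx => /(_ isT) mdelta.
pose pairw (s : measurableTypeR R) :
  (measurableTypeR R * g_sigma_algebraType (F T))%type := (s, w).
apply: (measurable_comp (F := `[t, T]%classic `*` setT) (g := pairw) _ _ mdelta).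
- by apply: measurableX => //; exact: measurable_itv.
- by move=> _ [s sT <-].
- apply: measurable_funTS.
  exact: (@pair2_measurable _ _ (measurableTypeR R) (g_sigma_algebraType (F T)) w).
Qed.

Section path_cost_parts.
Context {R : realType} (p : model R).
Hypothesis hp : standing_assumptions p.
Let lo := lfloor p.
Let T := horizon p.

Lemma phi_lipschitz x y c : lo <= x -> lo <= y -> dphi p x <= c -> dphi p y <= c ->
  `|phi p x - phi p y| <= c * `|x - y|.
Proof.
wlog xy : x y / x <= y.
  move=> H lx ly cx cy; have [xy|/ltW yx] := leP x y; first exact: H.
  by rewrite distrC [`|x - y|]distrC; exact: H.
move=> lx ly cx cy.
rewrite distrC [`|x - y|]distrC !ger0_norm ?subr_ge0//; last first.
  exact: sa_phi_mono.
apply: (@le_trans _ _ (dphi p y * (y - x))).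
  by have := dphi_tangent hp ly lx; rewrite -opprB mulrN -(opprB (phi p y)) lerN2.
by rewrite ler_wpM2r// subr_ge0.
Qed.

(** Each running maximum is bounded by the other one shifted by e + |m - m'|. *)
Lemma running_max_distance (t m m' e : R) (L1 L2 : R -> R) : t <= T ->
  {within `[t, T], continuous L1} -> {within `[t, T], continuous L2} ->
  (forall s, t <= s <= T -> `|L1 s - L2 s| <= e) -> 0 <= e ->
  `|running_max t m L1 T - running_max t m' L2 T| <= e + `|m - m'|.
Proof.
move=> tT c1 c2 H e0.
have half (a b : R) (l1 l2 : R -> R) : {within `[t, T], continuous l2} ->
    (forall s, t <= s <= T -> l1 s - l2 s <= e) ->
    running_max t a l1 T - running_max t b l2 T <= e + `|a - b|.
  move=> c12 h; rewrite lerBlDr; apply: running_max_le => //.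
    have h1 := running_max_ge_start t b l2 T; have := ler_norm (a - b).
    by clear -e0 h1; lra.
  move=> u /andP[tu uT]; have h1 : l2 u <= running_max t b l2 T.
    exact: (running_max_ge b c12 tu uT (lexx T)).
  have := h u; rewrite tu uT => /(_ isT); have := normr_ge0 (a - b).
  by clear -h1; lra.
rewrite ler_norml; apply/andP; split; last first.
  by apply: half => // s sT; apply: le_trans (ler_norm _) (H s sT).
rewrite lerNl opprB distrC; apply: half => // s sT.
by apply: le_trans (ler_norm _) _; rewrite distrC; exact: H.
Qed.

Variables (t : R) (delta_ : R -> R).
Hypotheses (t0 : 0 <= t) (tT : t <= T).
Hypothesis delta_meas : measurable_fun `[t, T] delta_.
Hypothesis delta_range : forall s, t <= s <= T -> dmin p <= delta_ s <= dmax p.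

Lemma itv_Rintegral_bound (f : R -> R) c : measurable_fun `[t, T] f ->
  (forall s, t <= s <= T -> `|f s| <= c) -> 0 <= c ->
  `|\int[lebesgue_measure]_(s in `[t, T]) f s|%R <= T * c.
Proof.
move=> mf fc c0; have intf := itv_integrable mf fc.
have intc (a : R) : lebesgue_measure.-integrable `[t, T] (EFin \o (fun=> a)).
  by apply: (@itv_integrable _ _ _ _ `|a|).
have len : fine (lebesgue_measure (`[t, T]%classic : set R)) <= T.
  rewrite lebesgue_measure_itv /= lte_fin; case: ifP => _ /=.
    by rewrite lerBlDr lerDl.
  exact: le_trans tT.
have len0 : 0 <= fine (lebesgue_measure (`[t, T]%classic : set R)).
  exact: fine_ge0.
have bnd : c * fine (lebesgue_measure (`[t, T]%classic : set R)) <= T * c.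
  by rewrite mulrC ler_wpM2r.
rewrite ler_norml; apply/andP; split.
  apply: (@le_trans _ _ (\int[lebesgue_measure]_(s in `[t, T]) (- c))%R).
    by rewrite Rintegral_cst// mulNr lerN2.
  apply: le_Rintegral => // s; rewrite /= in_itv /= => sT.
  by have := fc s sT; rewrite ler_norml => /andP[].
apply: (@le_trans _ _ (\int[lebesgue_measure]_(s in `[t, T]) c)%R).
  apply: le_Rintegral => // s; rewrite /= in_itv /= => sT.
  by have := fc s sT; rewrite ler_norml => /andP[].
by rewrite Rintegral_cst.
Qed.

Lemma itv_Rintegral_distance (f g : R -> R) a b c :
  measurable_fun `[t, T] f -> measurable_fun `[t, T] g ->
  (forall s, t <= s <= T -> `|f s| <= a) -> (forall s, t <= s <= T -> `|g s| <= b) ->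
  (forall s, t <= s <= T -> `|f s - g s| <= c) -> 0 <= c ->
  `|(\int[lebesgue_measure]_(s in `[t, T]) f s)%R -
    (\int[lebesgue_measure]_(s in `[t, T]) g s)%R| <= T * c.
Proof.
move=> mf mg fa gb fgc c0.
rewrite -RintegralB//; [|exact: itv_integrable fa|exact: itv_integrable gb].
by apply: itv_Rintegral_bound => //; exact: measurable_funB.
Qed.

Lemma running_cost_measurable (L_ : R -> R) : {within `[t, T], continuous L_} ->
  measurable_fun `[t, T] (fun s => running_cost p (L_ s) (delta_ s)).
Proof.
move=> Lc; have mL := continuous_itv_measurable Lc.
apply: measurable_funD.
  apply: measurable_funM => //; apply: measurable_funB => //.
  by apply: measurable_funD => //; apply: measurable_funM.
by apply: measurable_funM => //; apply: measurable_funX.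
Qed.

Lemma shortfall_measurable (L_ : R -> R) : {within `[t, T], continuous L_} ->
  measurable_fun `[t, T] (fun s => Pifun p s * Num.max (Bfun p s - L_ s) 0).
Proof.
have sub (f : R -> R) : {within `[0, T], continuous f} -> measurable_fun `[t, T] f.
  move=> fc; apply: continuous_itv_measurable; apply: continuous_subspaceW fc.
  by move=> s /=; rewrite !in_itv /= => /andP[ts ->]; rewrite (le_trans t0 ts).
move=> Lc; have mL := continuous_itv_measurable Lc.
apply: measurable_funM; first exact: sub (sa_Pi_cont hp).
apply: measurable_maxr => //; apply: measurable_funB => //.
exact: sub (sa_B_cont hp).
Qed.

End path_cost_parts.

Section path_cost_estimates.
Context {R : realType} (p : model R).
Hypothesis hp : standing_assumptions p.
Let lo := lfloor p.
Let T := horizon p.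
Let D := dmax p - dmin p.

Let D_ge0 : 0 <= D.
Proof. by have := sa_dmin hp; have := sa_dmax hp; rewrite /D; lra. Qed.

Lemma running_cost_bound (a Y x u : R) : 1 <= Y -> `|x| <= a * Y -> `|u| <= D ->
  `|running_cost p x u| <=
  ((`|icpt p - alpha0 p| + slope p * a) * D + beta p / 2 * D ^+ 2) * Y.
Proof.
move=> Y1 xa uD; rewrite /running_cost.
have Y0 : 0 <= Y by apply: le_trans Y1.
have u2 : `|u| ^+ 2 <= D ^+ 2 by rewrite lerXn2r ?nnegrE.
have b0 : 0 <= beta p / 2 by rewrite divr_ge0// ltW// (sa_beta hp).
have -> : icpt p + slope p * x - alpha0 p = icpt p - alpha0 p + slope p * x by ring.
rewrite [leRHS]mulrDl; apply: le_trans (ler_normD _ _) _; apply: lerD.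
  rewrite normrM mulrAC ler_pM//; apply: le_trans (ler_normD _ _) _.
  rewrite mulrDl lerD//; first by rewrite ler_peMr.
  by rewrite normrM (ger0_norm (sa_slope hp)) -mulrA ler_wpM2l// (sa_slope hp).
rewrite normrM normrX (ger0_norm b0) -[leRHS]mulrA ler_wpM2l//.
by apply: le_trans u2 _; rewrite ler_peMr// exprn_ge0.
Qed.

Lemma running_cost_distance (x y u e : R) : `|x - y| <= e -> `|u| <= D ->
  `|running_cost p x u - running_cost p y u| <= slope p * D * e.
Proof.
move=> xy uD; rewrite /running_cost.
rewrite (_ : _ - _ = slope p * ((x - y) * u)); last by ring.
rewrite normrM (ger0_norm (sa_slope hp)) -mulrA ler_wpM2l ?(sa_slope hp)//.
by rewrite normrM mulrC ler_pM.
Qed.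

Lemma shortfall_bound (a Y x b c B C : R) : 1 <= Y -> `|x| <= a * Y ->
  `|b| <= B -> `|c| <= C ->
  `|c * Num.max (b - x) 0| <= C * (B + a) * Y.
Proof.
move=> Y1 xa bB cC; rewrite normrM -mulrA ler_pM//.
have Y0 : 0 <= Y by apply: le_trans Y1.
have B0 : 0 <= B by apply: le_trans bB.
rewrite mulrDl; apply: (@le_trans _ _ (`|b| + `|x|)).
  by rewrite ger0_norm ?le_max ?lexx ?orbT// ge_max addr_ge0// andbT
    (le_trans (ler_norm _))// ler_normB.
by rewrite lerD// (le_trans bB)// ler_peMr.
Qed.

Lemma shortfall_distance (x y b c C e : R) : `|x - y| <= e -> `|c| <= C ->
  `|c * Num.max (b - x) 0 - c * Num.max (b - y) 0| <= C * e.
Proof.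
move=> xy cC; rewrite -mulrBr normrM ler_pM//; apply: le_trans xy.
rewrite ![Num.max _ 0]maxC.
apply: le_trans (dist_maxr_le _ _ _) _.
by rewrite distrC (_ : b - y - (b - x) = x - y)//; ring.
Qed.

Variables (t : R) (W_ delta_ : R -> R) (S0 R0 CT : R).
Hypotheses (t0 : 0 <= t) (tT : t <= T).
Hypothesis delta_meas : measurable_fun `[t, T] delta_.
Hypothesis delta_range : forall s, t <= s <= T -> dmin p <= delta_ s <= dmax p.
Hypotheses (S_ge0 : 0 <= S0)
  (W_bound : forall s : R, 0 <= s <= T -> `|W_ s - W_ 0| <= S0)
  (Theta_bound : forall s : R, 0 <= s <= T -> `|Theta p s| <= CT).

Let drift_max : R := T * (lambda p * (`|lo| + CT) + dmax p).

(** If S0 bounds the noise, a * (1 + S0) bounds 1 + |z| for z the load, the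
    initial maximum m and the terminal maximum. *)
Let a : R := R0 + `|lo| + drift_max + 2 * sigma p + 1.

Section one_path.
Variables (l m : R) (L_ k_ : R -> R).
Hypotheses (rp : reflected_path p t l W_ delta_ L_ k_)
  (lm : l <= m) (lR : `|l| <= R0) (mR : `|m| <= R0).

Let top : R := R0 + `|lo| + drift_max + 2 * sigma p * S0.

Let drift_ge0 : 0 <= drift_max.
Proof.
have CT0 : 0 <= CT.
  by apply: le_trans (Theta_bound (s := 0) _); rewrite // lexx ltW// (sa_T hp).
rewrite mulr_ge0 ?(ltW (sa_T hp))// addr_ge0 ?(ltW (sa_dmax hp))//.
by rewrite mulr_ge0 ?addr_ge0// ltW// (sa_lambda hp).
Qed.

Let top_le (x : R) : `|x| <= top -> `|x| + 1 <= a * (1 + S0).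
Proof.
move=> xtop; apply: (@le_trans _ _ (top + 1)); first by rewrite lerD2r.
have s0 : 0 <= 2 * sigma p by rewrite mulr_ge0// ltW// (sa_sigma hp).
have R00 : 0 <= R0 by apply: le_trans lR.
have lo0 : 0 <= `|lo| by [].
have x0 : 0 <= (R0 + `|lo| + drift_max + 1) * S0.
  by rewrite mulr_ge0// !addr_ge0.
have d0 := drift_ge0.
rewrite -subr_ge0.
rewrite (_ : _ - _ = 2 * sigma p + (R0 + `|lo| + drift_max + 1) * S0).
  by rewrite addr_ge0.
by rewrite /a /top; ring.
Qed.

Lemma load_le_top s : t <= s <= T -> L_ s <= top.
Proof.
move=> sT; apply: le_trans (reflected_upper_bound hp t0 tT delta_meas
  delta_range rp W_bound Theta_bound sT) _.
rewrite /top -[leRHS]addrA lerD2r ge_max; apply/andP; split.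
  by rewrite (le_trans (ler_norm _))// (le_trans lR)// lerDl.
by rewrite (le_trans (ler_norm _))// lerDr (le_trans (normr_ge0 l)).
Qed.

Let in_envelope (x : R) : lo <= x -> x <= top -> `|x| + 1 <= a * (1 + S0).
Proof.
move=> lox xtop; apply: top_le; rewrite ler_norml xtop andbT.
apply: le_trans lox; rewrite lerNl.
have s0 : 0 <= 2 * sigma p * S0 by rewrite !mulr_ge0// ltW// (sa_sigma hp).
have R00 : 0 <= R0 by apply: le_trans lR.
rewrite (le_trans (ler_norm _))// normrN /top.
by rewrite -[leRHS]addrA -[leRHS]addrA addrCA lerDl !addr_ge0.
Qed.

Lemma load_envelope s : t <= s <= T -> `|L_ s| + 1 <= a * (1 + S0).
Proof. by move=> sT; apply: in_envelope (rp_floor rp sT) (load_le_top sT). Qed.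

Lemma floor_le_start : lo <= m.
Proof.
by apply: le_trans lm; rewrite -(reflected_start tT rp) (rp_floor rp) ?lexx.
Qed.

Let m_top : m <= top.
Proof.
have s0 : 0 <= 2 * sigma p * S0 by rewrite !mulr_ge0// ltW// (sa_sigma hp).
rewrite (le_trans (ler_norm _))// (le_trans mR)// /top -!addrA lerDl.
by rewrite !addr_ge0.
Qed.

Lemma start_envelope : `|m| + 1 <= a * (1 + S0).
Proof. exact: in_envelope floor_le_start m_top. Qed.

Lemma floor_le_max : lo <= running_max t m L_ T.
Proof. exact: le_trans floor_le_start (running_max_ge_start _ _ _ _). Qed.

Lemma max_envelope : `|running_max t m L_ T| + 1 <= a * (1 + S0).
Proof.
apply: in_envelope floor_le_max _; apply: running_max_le => //.
by move=> u uT; exact: load_le_top.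
Qed.

Lemma path_costE : path_cost p t m L_ delta_ =
  (\int[lebesgue_measure]_(s in `[t, T]) running_cost p (L_ s) (delta_ s))%R
  + kappa p * (phi p (running_max t m L_ T) - phi p m)
  - (\int[lebesgue_measure]_(s in `[t, T])
       (Pifun p s * Num.max (Bfun p s - L_ s) 0))%R.
Proof.
rewrite /path_cost penalty_telescopes//.
- exact: rp_L_cont rp.
- exact: rp_floor rp.
- by rewrite (reflected_start tT rp).
Qed.

End one_path.

Variables (CB CP C : R) (n : nat).
Hypotheses (B_bound : forall s : R, 0 <= s <= T -> `|Bfun p s| <= CB)
  (Pi_bound : forall s : R, 0 <= s <= T -> `|Pifun p s| <= CP)
  (C_ge0 : 0 <= C)
  (growth : forall x : R, lo <= x -> `|phi p x| <= C * (`|x| + 1) ^+ n /\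
                                dphi p x <= C * (`|x| + 1) ^+ n).
Let Y : R := 1 + S0.

Let Y_ge1 : 1 <= Y. Proof. by rewrite lerDl. Qed.

(** The three cost terms grow at most like (1 + S0) ^+ n or 1 + S0; both are
    dominated by (1 + S0) ^+ n.+1. *)
Let growth_envelope (x : R) : lo <= x -> `|x| + 1 <= a * Y ->
  `|phi p x| <= C * a ^+ n * Y ^+ n.+1 /\ dphi p x <= C * a ^+ n * Y ^+ n.+1.
Proof.
move=> lox xa; have x1 : 0 <= `|x| + 1 by rewrite addr_ge0.
have aY : 0 <= a * Y by apply: le_trans xa.
have Y0 : 0 < Y by apply: lt_le_trans Y_ge1.
have a0 : 0 <= a by rewrite -(pmulr_lge0 _ Y0).
have le : C * (`|x| + 1) ^+ n <= C * a ^+ n * Y ^+ n.+1.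
  rewrite -mulrA ler_wpM2l//; apply: (@le_trans _ _ ((a * Y) ^+ n)).
    by rewrite lerXn2r ?nnegrE.
  by rewrite exprMn ler_wpM2l ?exprn_ge0// ler_weXn2l.
by have [h1 h2] := growth lox; split; [apply: le_trans le|apply: le_trans le].
Qed.

Let K1 : R := (`|icpt p - alpha0 p| + slope p * a) * D + beta p / 2 * D ^+ 2.
Let K2 : R := C * a ^+ n.
Let K3 : R := CP * (CB + a).

Let Y_le_pow : Y <= Y ^+ n.+1.
Proof. by rewrite -[leLHS]expr1 ler_weXn2l. Qed.

Let pow_ge1 : 1 <= Y ^+ n.+1.
Proof. exact: le_trans Y_ge1 Y_le_pow. Qed.

Let in_time s : t <= s <= T -> 0 <= s <= T.
Proof. by move=> /andP[ts ->]; rewrite (le_trans t0 ts). Qed.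

Let T_ge0 : 0 <= T. Proof. exact: ltW (sa_T hp). Qed.

Let CP_ge0 : 0 <= CP.
Proof. by apply: le_trans (Pi_bound (s := 0) _); rewrite // lexx T_ge0. Qed.

Section bounds.
Variables (l m : R) (L_ k_ : R -> R).
Hypotheses (rp : reflected_path p t l W_ delta_ L_ k_)
  (lm : l <= m) (lR : `|l| <= R0) (mR : `|m| <= R0).

Let load_le s : t <= s <= T -> `|L_ s| <= a * Y.
Proof.
by move=> sT; apply: le_trans (load_envelope rp lR sT); rewrite lerDl.
Qed.

Lemma running_cost_path_bound s : t <= s <= T ->
  `|running_cost p (L_ s) (delta_ s)| <= K1 * Y.
Proof.
move=> sT; apply: running_cost_bound => //; first exact: load_le.
exact: (control_bounded hp delta_range sT).
Qed.

Lemma shortfall_path_bound s : t <= s <= T ->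
  `|Pifun p s * Num.max (Bfun p s - L_ s) 0| <= K3 * Y.
Proof.
move=> sT; apply: shortfall_bound => //; first exact: load_le.
  exact: B_bound (in_time sT).
exact: Pi_bound (in_time sT).
Qed.

Lemma path_cost_bound : `|path_cost p t m L_ delta_| <=
  (T * K1 + kappa p * (2 * K2) + T * K3) * Y ^+ n.+1.
Proof.
rewrite (path_costE rp lm).
have [phM _] := growth_envelope (floor_le_max rp lm) (max_envelope rp lm lR mR).
have [phm _] := growth_envelope (floor_le_start rp lm) (start_envelope rp lm lR mR).
have K1Y : 0 <= K1 * Y.
  by apply: le_trans (running_cost_path_bound (s := t) _); rewrite // lexx.
have K3Y : 0 <= K3 * Y.
  by apply: le_trans (shortfall_path_bound (s := t) _); rewrite // lexx.
have Y0 : 0 < Y by apply: lt_le_trans Y_ge1.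
have K1_ge0 : 0 <= K1 by rewrite -(pmulr_lge0 _ Y0).
have K3_ge0 : 0 <= K3 by rewrite -(pmulr_lge0 _ Y0).
rewrite [leRHS]mulrDl [X in _ <= X + _]mulrDl.
apply: le_trans (ler_normB _ _) _; apply: lerD.
  apply: le_trans (ler_normD _ _) _; apply: lerD.
    rewrite -mulrA; apply: (@le_trans _ _ (T * (K1 * Y))).
      apply: itv_Rintegral_bound => //; last exact: running_cost_path_bound.
      exact: (running_cost_measurable delta_meas (rp_L_cont rp)).
    by rewrite ler_wpM2l// ler_wpM2l.
  rewrite normrM (gtr0_norm (sa_kappa hp)) -mulrA ler_wpM2l ?(ltW (sa_kappa hp))//.
  by apply: le_trans (ler_normB _ _) _; rewrite -mulrA mulr_natl mulr2n lerD.
rewrite -mulrA; apply: (@le_trans _ _ (T * (K3 * Y))).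
  apply: itv_Rintegral_bound => //; last exact: shortfall_path_bound.
  exact: (shortfall_measurable hp t0 (rp_L_cont rp)).
by rewrite ler_wpM2l// ler_wpM2l.
Qed.

End bounds.

Lemma path_cost_distance l m (L_ k_ : R -> R) l' m' (L'_ k'_ : R -> R) :
  reflected_path p t l W_ delta_ L_ k_ -> l <= m -> `|l| <= R0 -> `|m| <= R0 ->
  reflected_path p t l' W_ delta_ L'_ k'_ -> l' <= m' -> `|l'| <= R0 -> `|m'| <= R0 ->
  `|path_cost p t m L_ delta_ - path_cost p t m' L'_ delta_| <=
  (T * (slope p * D) + kappa p * (2 * K2) + T * CP) * Y ^+ n.+1 *
  (`|l - l'| + `|m - m'|).
Proof.
move=> rp lm lR mR rp' lm' lR' mR'.
rewrite (path_costE rp lm) (path_costE rp' lm').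
set e := `|l - l'|; set E := e + `|m - m'|.
have e0 : 0 <= e := normr_ge0 _.
have E0 : 0 <= E by rewrite addr_ge0.
have eE : e <= E by rewrite lerDl.
have LL s : t <= s <= T -> `|L_ s - L'_ s| <= e.
  move=> sT; rewrite ler_norml; apply/andP; split.
    rewrite lerNl opprB /e distrC.
    exact: (reflected_contraction hp t0 tT delta_meas delta_range rp' rp sT).
  exact: (reflected_contraction hp t0 tT delta_meas delta_range rp rp' sT).
have [_ dM] := growth_envelope (floor_le_max rp lm) (max_envelope rp lm lR mR).
have [_ dm] := growth_envelope (floor_le_start rp lm) (start_envelope rp lm lR mR).
have [_ dM'] := growth_envelope (floor_le_max rp' lm') (max_envelope rp' lm' lR' mR').
have [_ dm'] := growth_envelope (floor_le_start rp' lm') (start_envelope rp' lm' lR' mR').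
have H0 : 0 <= C * a ^+ n * Y ^+ n.+1.
  exact: le_trans (dphi_ge0 hp (floor_le_start rp lm)) dm.
have hM : `|phi p (running_max t m L_ T) - phi p (running_max t m' L'_ T)|
    <= C * a ^+ n * Y ^+ n.+1 * E.
  apply: le_trans (phi_lipschitz hp (floor_le_max rp lm) (floor_le_max rp' lm') dM dM') _.
  rewrite ler_wpM2l//.
  exact: (running_max_distance m m' tT (rp_L_cont rp) (rp_L_cont rp') LL e0).
have hm : `|phi p m - phi p m'| <= C * a ^+ n * Y ^+ n.+1 * E.
  apply: le_trans
    (phi_lipschitz hp (floor_le_start rp lm) (floor_le_start rp' lm') dm dm') _.
  by rewrite ler_wpM2l// lerDr.
have h1 : `|(\int[lebesgue_measure]_(s in `[t, T]) running_cost p (L_ s) (delta_ s))%R -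
   (\int[lebesgue_measure]_(s in `[t, T]) running_cost p (L'_ s) (delta_ s))%R|
   <= T * (slope p * D) * (Y ^+ n.+1 * E).
  rewrite -mulrA; apply: (@le_trans _ _ (T * (slope p * D * e))).
    apply: (itv_Rintegral_distance t0 tT
      (running_cost_measurable delta_meas (rp_L_cont rp))
      (running_cost_measurable delta_meas (rp_L_cont rp'))
      (running_cost_path_bound rp lR) (running_cost_path_bound rp' lR')).
      move=> s sT; apply: running_cost_distance; first exact: LL.
      exact: (control_bounded hp delta_range sT).
    by rewrite !mulr_ge0// (sa_slope hp).
  rewrite ler_wpM2l// ler_wpM2l//; first by rewrite mulr_ge0// (sa_slope hp).
  by rewrite (le_trans eE)// ler_peMl.
have h3 : `|(\int[lebesgue_measure]_(s in `[t, T])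
     (Pifun p s * Num.max (Bfun p s - L_ s) 0))%R -
   (\int[lebesgue_measure]_(s in `[t, T])
     (Pifun p s * Num.max (Bfun p s - L'_ s) 0))%R| <= T * CP * (Y ^+ n.+1 * E).
  rewrite -mulrA; apply: (@le_trans _ _ (T * (CP * e))).
    apply: (itv_Rintegral_distance t0 tT (shortfall_measurable hp t0 (rp_L_cont rp))
      (shortfall_measurable hp t0 (rp_L_cont rp'))
      (shortfall_path_bound rp lR) (shortfall_path_bound rp' lR')).
      move=> s sT; apply: shortfall_distance; first exact: LL.
      exact: Pi_bound (in_time sT).
    by rewrite mulr_ge0.
  by rewrite ler_wpM2l// ler_wpM2l// (le_trans eE)// ler_peMl.
move: h1 h3; set I1 := Rintegral _ _ _; set I1' := Rintegral _ _ _.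
set I3 := Rintegral _ _ _; set I3' := Rintegral _ _ _.
move=> h1 h3.
have h2 : `|kappa p * (phi p (running_max t m L_ T) - phi p m) -
    kappa p * (phi p (running_max t m' L'_ T) - phi p m')| <=
    kappa p * (2 * K2) * (Y ^+ n.+1 * E).
  rewrite -mulrBr normrM (gtr0_norm (sa_kappa hp)) -[leRHS]mulrA.
  rewrite ler_wpM2l ?(ltW (sa_kappa hp))//.
  rewrite (_ : phi p _ - _ - _ =
    phi p (running_max t m L_ T) - phi p (running_max t m' L'_ T) -
    (phi p m - phi p m')); last by ring.
  apply: le_trans (ler_normB _ _) _.
  rewrite (_ : 2 * K2 * _ = C * a ^+ n * Y ^+ n.+1 * E + C * a ^+ n * Y ^+ n.+1 * E).
    by rewrite lerD.
  by rewrite /K2; ring.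
rewrite -mulrA [leRHS]mulrDl [X in _ <= X + _]mulrDl.
set J2 := kappa p * (_ - _) in h2 *; set J2' := kappa p * (_ - _) in h2 *.
have -> : I1 + J2 - I3 - (I1' + J2' - I3') = (I1 - I1') + (J2 - J2') - (I3 - I3').
  by ring.
apply: le_trans (ler_normB _ _) _; apply: lerD => //.
by apply: le_trans (ler_normD _ _) _; apply: lerD.
Qed.

End path_cost_estimates.

(** * Regularity of the value function *)

(** The constants depend on the model and on R0 only. Their independence of the
    control is what lets the infima over controls be compared, and that of t
    gives a Lipschitz constant uniform in time. *)
Lemma path_cost_estimates {R : realType} (p : model R) (R0 : R) :
  standing_assumptions p ->
  exists (Kb Kd : R) (n : nat), [/\ 0 <= Kb, 0 <= Kd &
  forall (t : R) (W_ delta_ : R -> R) (S0 : R),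
    0 <= t -> t <= horizon p -> measurable_fun `[t, horizon p] delta_ ->
    (forall s, t <= s <= horizon p -> dmin p <= delta_ s <= dmax p) ->
    0 <= S0 -> (forall s : R, 0 <= s <= horizon p -> `|W_ s - W_ 0| <= S0) ->
  (forall l m (L_ k_ : R -> R),
    reflected_path p t l W_ delta_ L_ k_ -> l <= m -> `|l| <= R0 -> `|m| <= R0 ->
    `|path_cost p t m L_ delta_| <= Kb * (1 + S0) ^+ n) /\
  (forall l m (L_ k_ : R -> R) l' m' (L'_ k'_ : R -> R),
    reflected_path p t l W_ delta_ L_ k_ -> l <= m -> `|l| <= R0 -> `|m| <= R0 ->
    reflected_path p t l' W_ delta_ L'_ k'_ ->
    l' <= m' -> `|l'| <= R0 -> `|m'| <= R0 ->
    `|path_cost p t m L_ delta_ - path_cost p t m' L'_ delta_| <=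
    Kd * (`|l - l'| + `|m - m'|) * (1 + S0) ^+ n)].
Proof.
move=> hp.
have [CT hT] := sa_Theta_bnd hp; have [CB hB] := sa_B_bnd hp.
have [CP hP] := sa_Pi_bnd hp.
have [C [n [C0 growth]]] := phi_polynomial_growth hp.
eexists `|_|, `|_|, n.+1; split; [exact: normr_ge0|exact: normr_ge0|].
move=> t W_ delta_ S0 t0 tT md dr S00 WS; split.
  move=> l m L_ k_ rp lm lR mR.
  apply: le_trans (path_cost_bound hp t0 tT md dr S00 WS hT hB hP C0 growth
    rp lm lR mR) _.
  apply: ler_wpM2r; last exact: ler_norm.
  by rewrite exprn_ge0// addr_ge0.
move=> l m L_ k_ l' m' L'_ k'_ rp lm lR mR rp' lm' lR' mR'.
apply: le_trans (path_cost_distance hp t0 tT md dr S00 WS hT hB hP C0 growth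
  rp lm lR mR rp' lm' lR' mR') _.
rewrite mulrAC ler_wpM2r ?exprn_ge0 ?addr_ge0//.
by apply: ler_wpM2r; [rewrite addr_ge0|exact: ler_norm].
Qed.

Section value_function.
Context {R : realType} (p : model R) (d : measure_display)
  (Omega : measurableType d) (P : probability Omega R)
  (F : R -> set (set Omega)) (W : R -> Omega -> R)
  (L k : R -> R -> (R -> Omega -> R) -> R -> Omega -> R).
Hypotheses (hp : standing_assumptions p) (hF : usual_conditions (horizon p) P F)
  (hW : brownian_motion (horizon p) P F W) (hL : load_family p P F W L k).

Lemma admissible_nonempty t : admissible p F t !=set0.
Proof.
exists (fun _ _ => 0); split; first by move=> s st; exact: measurable_cst.
by move=> s w _; rewrite (ltW (sa_dmin hp)) (ltW (sa_dmax hp)).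
Qed.

(** The power of the supremum of the noise is replaced by an integrable majorant,
    the same for all controls, and averaged. *)
Lemma cost_estimates (R0 : R) : exists (Cb Cd : R), 0 <= Cd /\
  forall (t : R) delta, 0 <= t <= horizon p -> admissible p F t delta ->
  (forall l m, lfloor p <= l -> l <= m -> `|l| <= R0 -> `|m| <= R0 ->
    cost p P L t l m delta \is a fin_num /\
    `|fine (cost p P L t l m delta)| <= Cb) /\
  (forall l m l' m', lfloor p <= l -> l <= m -> `|l| <= R0 -> `|m| <= R0 ->
    lfloor p <= l' -> l' <= m' -> `|l'| <= R0 -> `|m'| <= R0 ->
    `|fine (cost p P L t l m delta) - fine (cost p P L t l' m' delta)| <=
    Cd * (`|l - l'| + `|m - m'|)).
Proof.
have [Kb [Kd [n [Kb0 Kd0 est]]]] := path_cost_estimates R0 hp.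
have [H [mH H0 Hoo HS]] := brownian_sup_moment n (sa_T hp) hF hW.
have IH : (\int[P]_w H w \is a fin_num)%E.
  by rewrite ge0_fin_numE// integral_ge0.
set I := fine (\int[P]_w H w)%E.
have IE : (\int[P]_w H w = I%:E)%E by rewrite /I fineK.
have I0 : 0 <= I by rewrite fine_ge0// integral_ge0.
have ZE (c : R) : 0 <= c -> [/\ measurable_fun setT (fun w => c%:E * H w)%E,
    forall w, (0 <= c%:E * H w)%E & (\int[P]_w (c%:E * H w) = (c * I)%:E)%E].
  move=> c0; split.
  - exact: emeasurable_funM.
  - by move=> w; rewrite mule_ge0 ?lee_fin.
  - by rewrite ge0_integralZl// IE.
exists (Kb * I + Kb * I), (Kd * I + Kd * I); split.
  by rewrite addr_ge0// mulr_ge0.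
move=> t delta tT adm; have /andP[t0 tT'] := tT.
have [prog range] := adm.
have md w := progressive_path_measurable w tT' prog.
have dr w s (st : t <= s <= horizon p) := range s w st.
have bnd l m : lfloor p <= l -> l <= m -> `|l| <= R0 -> `|m| <= R0 ->
    {ae P, forall w, (`|path_cost p t m (L t l delta ^~ w) (delta^~ w)|%:E
      <= Kb%:E * H w)%E}.
  move=> ll lm lR mR; have [_ _ rp] := hL tT ll adm.
  apply: filterS2 rp HS => w rpw [S [S0 WS SH]].
  have [b _] := est t _ _ S t0 tT' (md w) (dr w) S0 WS.
  apply: (@le_trans _ _ (Kb%:E * ((1 + S) ^+ n)%:E)%E).
    by rewrite -EFinM lee_fin; exact: b rpw lm lR mR.
  by rewrite lee_wpmul2l// lee_fin.
have [mZb Zb0 IZb] := ZE Kb Kb0.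
have IZboo : (\int[P]_w (Kb%:E * H w) < +oo)%E by rewrite IZb ltry.
split.
  move=> l m ll lm lR mR.
  have [fin le] := integral_dominated_ae Zb0 mZb (bnd l m ll lm lR mR) IZboo.
  rewrite /cost unlock; split => //.
  by move: le; rewrite IZb -(fineK fin) -EFinD lee_fin.
move=> l m l' m' ll lm lR mR ll' lm' lR' mR'.
set e := `|l - l'| + `|m - m'|.
have e0 : 0 <= e by rewrite addr_ge0.
have [mZd Zd0 IZd] := ZE (Kd * e) (mulr_ge0 Kd0 e0).
have IZdoo : (\int[P]_w ((Kd * e)%:E * H w) < +oo)%E by rewrite IZd ltry.
have dist : {ae P, forall w,
    (`|path_cost p t m (L t l delta ^~ w) (delta^~ w) -
       path_cost p t m' (L t l' delta ^~ w) (delta^~ w)|%:E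
      <= (Kd * e)%:E * H w)%E}.
  have [_ _ rp] := hL tT ll adm; have [_ _ rp'] := hL tT ll' adm.
  apply: filterS3 rp rp' HS => w rpw rpw' [S [S0 WS SH]].
  have [_ b] := est t _ _ S t0 tT' (md w) (dr w) S0 WS.
  apply: (@le_trans _ _ ((Kd * e)%:E * ((1 + S) ^+ n)%:E)%E).
    by rewrite -EFinM lee_fin; exact: b rpw lm lR mR rpw' lm' lR' mR'.
  by rewrite lee_wpmul2l// lee_fin mulr_ge0.
have [fin _] := integral_dominated_ae Zb0 mZb (bnd l m ll lm lR mR) IZboo.
have [fin' _] := integral_dominated_ae Zb0 mZb (bnd l' m' ll' lm' lR' mR') IZboo.
have := integral_distance_ae Zd0 mZd IZdoo Zb0 mZb IZboo
  (bnd l m ll lm lR mR) (bnd l' m' ll' lm' lR' mR') dist.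
rewrite /cost unlock IZd -(fineK fin) -(fineK fin') -!EFinD lee_fin /=.
move=> h; apply: le_trans h _.
by rewrite le_eqVlt; apply/orP; left; apply/eqP; ring.
Qed.

End value_function.

Theorem proposition4p1 (R : realType) (p : model R)
    (d : measure_display) (Omega : measurableType d)
    (P : probability Omega R) (F : R -> set (set Omega))
    (W : R -> Omega -> R)
    (L k : R -> R -> (R -> Omega -> R) -> R -> Omega -> R)
    (hp : standing_assumptions p)
    (hF : usual_conditions (horizon p) P F)
    (hW : brownian_motion (horizon p) P F W)
    (hL : load_family p P F W L k)
    (K : set (R * R)) (hK : compact K) (hKD : K `<=` state_space p) :
  exists C : R, 0 < C /\
    forall t : R, 0 <= t <= horizon p ->
    forall x y : R * R, K x -> K y ->
      (`|value p P F L t x.1 x.2 - value p P F L t y.1 y.2|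
         <= (C * (`|x.1 - y.1| + `|x.2 - y.2|))%:E)%E.
Proof.
have [R0 KR0] : exists R0 : R, forall x, K x -> `|x.1| <= R0 /\ `|x.2| <= R0.
  have [M [_ /(_ (M + 1))]] := compact_bounded hK.
  rewrite ltrDl => /(_ ltr01) KM; exists (M + 1) => x Kx.
  by have /= := KM x Kx; rewrite prod_normE ge_max => /andP[].
have [Cb [Cd [Cd0 est]]] := cost_estimates hp hF hW hL R0.
exists (Cd + 1); split; first by rewrite ltr_wpDl.
move=> t tT x y Kx Ky.
have [lx xx] := hKD x Kx; have [ly yy] := hKD y Ky.
have [x1 x2] := KR0 x Kx; have [y1 y2] := KR0 y Ky.
have valueE z : K z -> value p P F L t z.1 z.2 = ereal_inf
    [set (fine (cost p P L t z.1 z.2 delta))%:E | delta in admissible p F t].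
  move=> Kz; congr ereal_inf; apply: eq_imagel => delta adm.
  have [z1 z2] := KR0 z Kz; have [lz zz] := hKD z Kz.
  have [/(_ z.1 z.2 lz zz z1 z2)[fin _] _] := est t delta tT adm.
  by rewrite fineK.
rewrite !valueE//; apply: (@le_trans _ _
    (Cd * (`|x.1 - y.1| + `|x.2 - y.2|))%:E); last first.
  by rewrite lee_fin ler_wpM2r ?addr_ge0// lerDl.
apply: (@ereal_inf_distance _ _ _ _ _ Cb).
- exact: admissible_nonempty.
- move=> delta adm.
  by have [/(_ x.1 x.2 lx xx x1 x2)[]] := est t delta tT adm.
- move=> delta adm.
  by have [/(_ y.1 y.2 ly yy y1 y2)[]] := est t delta tT adm.
- move=> delta adm; have [_ dist] := est t delta tT adm.
  exact: dist.
Qed.
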